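(* Let $r\ge2$ be an integer and $K$ a triangle. The shape functions for the bubble space $b_K\sum_{i=1}^3b_iQ_i^{r-2}(K)$ associated with the degrees of freedom \[ v\mapsto\frac1{|e_i|}\int_{e_i}\frac{\partial v}{\partial\boldsymbol n}\,P_k^{(2,2)}(\lambda_i^+-\lambda_i^-)\,d\sigma(\boldsymbol x),\qquad i=1,2,3,\quad k=0,\dots,r-2, \] are \[ a_{k,r-2}\,b_Kb_i\,P_{k,r-2}^{(1,2,2)}(\lambda_i,\lambda_i^+,\lambda_i^-) \] with \[ a_{k,r-2}=\frac{(-1)^{r-k-1}}{|\nabla\lambda_i|}\,\frac{(k+3)(k+4)(2k+5)}{(r-k-1)(k+1)(k+2)},\qquad k=0,\dots,r-2. \]
   Context: $K$ is a triangle with barycentric coordinates $\lambda_1,\lambda_2,\lambda_3$, edges $e_1,e_2,e_3$ with $\lambda_i\equiv0$ on $e_i$, and outward unit normal $\boldsymbol n$ on $\partial K$. For each $i$, $\lambda_i^+$ and $\lambda_i^-$ are the two other barycentric coordinates, associated with the edges $e_i^+$ and $e_i^-$ (on which they vanish, respectively), where $(e_i,e_i^+,e_i^-)$ are ordered counterclockwise. $b_K=\lambda_1\lambda_2\lambda_3$, $b_i=b_K/\lambda_i$. With $\mathbb P_m=\{0\}$ for $m<0$, \[ Q_i^{r-2}(K)=\Bigl\{v\in\mathbb P_{r-2}(K):\int_K b_Kb_i v q\,d\boldsymbol x=0\ \text{for all }q\in\mathbb P_{r-3}(K)\Bigr\}. \] $P_n^{(\alpha,\beta)}$ ($\alpha,\beta>-1$)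 is the Jacobi polynomial given by \[ (1-t)^\alpha(1+t)^\beta P_n^{(\alpha,\beta)}(t)=\frac{(-1)^n}{2^nn!}\frac{d^n}{dt^n}\bigl((1-t)^{n+\alpha}(1+t)^{n+\beta}\bigr), \] and for integers $0\le k\le n$ and $\alpha,\beta,\gamma>-1$, on $\lambda_1+\lambda_2+\lambda_3=1$, \[ P_{k,n}^{(\alpha,\beta,\gamma)}(\lambda_1,\lambda_2,\lambda_3)=(\lambda_2+\lambda_3)^kP_{n-k}^{(2k+\beta+\gamma+1,\alpha)}(\lambda_1-\lambda_2-\lambda_3)\,P_k^{(\gamma,\beta)}\Bigl(\frac{\lambda_2-\lambda_3}{\lambda_2+\lambda_3}\Bigr), \] which is a polynomial in $\mathbb P_n(K)$. The shape functions of a finite-dimensional space associated with given degrees of freedom are the basis of that space dual to these functionals: the shape function indexed by $(i,k)$ gives value $1$ on the degree of freedom indexed by $(i,k)$ and $0$ on all others. *)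

(* Defs.v *)
From HB Require Import structures.
From mathcomp Require Import all_boot all_order all_algebra.
From mathcomp Require Import all_classical all_reals all_analysis.
From mathcomp Require Import ring lra.

Set Implicit Arguments.
Unset Strict Implicit.
Unset Printing Implicit Defensive.

Import Order.TTheory GRing.Theory Num.Theory.
Import numFieldNormedType.Exports.

Local Open Scope classical_set_scope.
Local Open Scope ring_scope.

Section Jacobi.
Context {R : realType}.
Implicit Types (a b c t : R) (n k : nat) (p q : {poly R}).

(* Rodrigues' formula, required only on ]-1, 1[, where the real powers are
   genuine: outside, powR takes junk values at negative bases. *)
Definition is_jacobi a b n p : Prop :=
  forall t, -1 < t < 1 ->
    (1 - t) `^ a * (1 + t) `^ b * p.[t] =
    (-1) ^+ n / (2 ^+ n * n`!%:R) *
    derive1n n (fun s : R => (1 - s) `^ (n%:R + a) * (1 + s) `^ (n%:R + b)) t.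

(* The default value 0 is never used: see jacobiP and jacobi_unique. *)
Definition jacobi a b n : {poly R} := xget 0 [set p | is_jacobi a b n p].

(* The factor (l2 + l3)^k P_k((l2 - l3) / (l2 + l3)) is written as the
   homogenization of P_k, so that it is the intended polynomial also where
   l2 + l3 = 0; see koornwinderE. *)
Definition koornwinder a b c k n (l1 l2 l3 : R) : R :=
  (\sum_(j < k.+1) (jacobi c b k)`_j * (l2 - l3) ^+ j * (l2 + l3) ^+ (k - j)) *
  (jacobi ((2 * k)%:R + b + c + 1) a (n - k)).[l1 - l2 - l3].

Lemma derive1n_powR2 a b n : exists2 q : {poly R}, (size q <= n.+1)%N &
  forall t, -1 < t < 1 ->
    derive1n n (fun s : R => (1 - s) `^ a * (1 + s) `^ b) t =
    (1 - t) `^ (a - n%:R) * (1 + t) `^ (b - n%:R) * q.[t].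
Proof.
elim: n => [|n [q sq Hq]].
  exists 1; first by rewrite size_poly1.
  by move=> t _; rewrite derive1n0 !subr0 hornerC mulr1.
pose Y : {poly R} := 1 - 'X.
pose Z : {poly R} := 1 + 'X.
pose L : {poly R} := (b - n%:R) *: Y - (a - n%:R) *: Z.
exists (L * q + Y * Z * q^`()).
  have sY : (size Y <= 2)%N.
    rewrite (leq_trans (size_polyD _ _)) // size_polyN size_polyX.
    by rewrite size_poly1.
  have sZ : (size Z <= 2)%N.
    by rewrite (leq_trans (size_polyD _ _)) // size_polyX size_poly1.
  have sL : (size L <= 2)%N.
    rewrite (leq_trans (size_polyD _ _)) // size_polyN geq_max.
    by rewrite !(leq_trans (size_scale_leq _ _)).
  rewrite (leq_trans (size_polyD _ _)) // geq_max; apply/andP; split.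
    rewrite (leq_trans (size_polyMleq _ _)) //.
    by move: (leq_add sL sq); case: (size L + size q)%N.
  have s3 : (size (Y * Z)%R <= 3)%N.
    rewrite (leq_trans (size_polyMleq _ _)) //.
    by move: (leq_add sY sZ); case: (_ + _)%N.
  have [->|q'0] := eqVneq q^`() 0; first by rewrite mulr0 size_poly0.
  have sq' : (size q^`() <= n)%N.
    have q0 : q != 0 by apply: contraNneq q'0 => ->; rewrite deriv0.
    by rewrite -ltnS (leq_trans (lt_size_deriv q0)).
  rewrite (leq_trans (size_polyMleq _ _)) //.
  by move: (leq_add s3 sq'); case: (_ + _)%N.
move=> t ht; have /andP[t1 t2] := ht; rewrite derive1nS derive1E.
pose g (s : R) : R := (1 - s) `^ (a - n%:R) * (1 + s) `^ (b - n%:R) * q.[s].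
have nt : \forall s \near t, derive1n n
    (fun s : R => (1 - s) `^ a * (1 + s) `^ b) s = g s.
  have tI : t \in `](-1), 1[ by rewrite in_itv.
  near=> s; apply: Hq.
  have : s \in `](-1), 1[ by near: s; exact: near_in_itvoo.
  by rewrite in_itv.
rewrite (near_eq_derive _ nt).
have y0 : 0 < 1 - t by rewrite subr_gt0.
have z0 : 0 < 1 + t by rewrite addrC -ltrBlDr sub0r.
have dY : is_derive t (1 : R) (fun s : R => 1 - s) (-1 : R).
  by apply: is_derive_eq; rewrite add0r mul1r.
have dZ : is_derive t (1 : R) (fun s : R => 1 + s) (1 : R).
  by apply: is_derive_eq; rewrite add0r mulr1.
have dYa c : is_derive t (1 : R) (fun s : R => (1 - s) `^ c)
    (-1 * (c * (1 - t) `^ (c - 1))).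
  have h := is_derive1_powR c y0.
  by have := @is_derive1_comp R (fun x => x `^ c) (fun s => 1 - s) t _ _ h dY; rewrite mulrC.
have dZa c : is_derive t (1 : R) (fun s : R => (1 + s) `^ c)
    (c * (1 + t) `^ (c - 1)).
  have h := is_derive1_powR c z0.
  by have := @is_derive1_comp R (fun x => x `^ c) (fun s => 1 + s) t _ _ h dZ; rewrite mulr1.
have -> : 'D_1 g t = 
  ((1 - t) `^ (a - n%:R) * (1 + t) `^ (b - n%:R)) * q^`().[t] +
  q.[t] * ((1 - t) `^ (a - n%:R) * ((b - n%:R) * (1 + t) `^ (b - n%:R - 1)) +
    (1 + t) `^ (b - n%:R) * (-1 * ((a - n%:R) * (1 - t) `^ (a - n%:R - 1)))).
  have := dYa (a - n%:R); have := dZa (b - n%:R) => hz hy.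
  exact: (@derive_val _ _ _ _ _ _ _ (is_deriveM (is_deriveM hy hz) (is_derive_poly q t))).
have e c x : 0 < x -> x `^ (c - n%:R) = x * x `^ (c - n.+1%:R).
  move=> x0; have -> : c - n%:R = 1 + (c - n.+1%:R).
    by rewrite -natr1; ring.
  rewrite [LHS]powRD ?powRr1 // ?ltW //.
  by apply/implyP => _; rewrite gt_eqF.
have e' c : c - n%:R - 1 = c - n.+1%:R by rewrite -natr1; ring.
have -> : (L * q + Y * Z * q^`()).[t] =
    ((b - n%:R) * (1 - t) - (a - n%:R) * (1 + t)) * q.[t] +
    (1 - t) * (1 + t) * q^`().[t].
  by rewrite /L /Y /Z !hornerE.
rewrite !e' !e //; ring.
Unshelve. all: by end_near. Qed.

Lemma is_jacobi_ex a b n :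
  exists2 p : {poly R}, (size p <= n.+1)%N & is_jacobi a b n p.
Proof.
have [q sq Hq] := derive1n_powR2 (n%:R + a) (n%:R + b) n.
exists (((-1) ^+ n / (2 ^+ n * n`!%:R)) *: q).
  by rewrite (leq_trans (size_scale_leq _ _)).
move=> t ht; rewrite Hq // hornerZ.
have -> : n%:R + a - n%:R = a by ring.
have -> : n%:R + b - n%:R = b by ring.
by rewrite mulrCA.
Qed.

Lemma is_jacobi_uniq a b n p q : is_jacobi a b n p -> is_jacobi a b n q -> p = q.
Proof.
move=> hp hq; apply/eqP; rewrite -subr_eq0; apply/eqP.
pose u (k : nat) : R := k.+2%:R^-1.
have uI k : -1 < u k < 1.
  rewrite (@lt_trans _ _ 0) ?oppr_lt0 ?invr_gt0 //= invf_lt1 ?ltr1n //.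
apply: (@roots_geq_poly_eq0 _ _ [seq u k | k <- iota 0 (size (p - q))]).
- apply/allP => _ /mapP[k _ ->]; rewrite rootE hornerD hornerN subr_eq0.
  have /andP[u1 u2] := uI k; apply/eqP.
  have := hp _ (uI k); rewrite -(hq _ (uI k)); apply: mulfI.
  rewrite mulf_neq0 // gt_eqF // powR_gt0 //; first by rewrite subr_gt0.
  by rewrite addrC -ltrBlDr sub0r.
- rewrite map_inj_uniq ?iota_uniq // => i j /invr_inj /eqP.
  by rewrite eqr_nat => /eqP[].
- by rewrite size_map size_iota.
Qed.

Lemma jacobiP a b n : is_jacobi a b n (jacobi a b n).
Proof. by have [p _ hp] := is_jacobi_ex a b n; apply: (xgetPex 0); exists p. Qed.

Lemma jacobi_unique a b n p : is_jacobi a b n p -> p = jacobi a b n.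
Proof. by move=> hp; apply: is_jacobi_uniq hp (jacobiP _ _ _). Qed.

Lemma size_jacobi a b n : (size (jacobi a b n) <= n.+1)%N.
Proof. by have [p sp /jacobi_unique <-] := is_jacobi_ex a b n. Qed.

Lemma koornwinderE a b c k n l1 l2 l3 : l2 + l3 != 0 ->
  koornwinder a b c k n l1 l2 l3 =
  (l2 + l3) ^+ k * (jacobi ((2 * k)%:R + b + c + 1) a (n - k)).[l1 - l2 - l3] *
  (jacobi c b k).[(l2 - l3) / (l2 + l3)].
Proof.
move=> s0; rewrite /koornwinder mulrAC; congr (_ * _).
rewrite (horner_coef_wide _ (size_jacobi c b k)) mulr_sumr.
apply: eq_bigr => j _.
have -> : (l2 + l3) ^+ k = (l2 + l3) ^+ (k - j) * (l2 + l3) ^+ j.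
  by rewrite -exprD subnK // -ltnS.
by rewrite expr_div_n; field; rewrite expf_neq0.
Qed.

End Jacobi.

Section Triangle.
Context {R : realType}.
Implicit Types (v : 'I_3 -> R * R) (i : 'I_3) (x y : R * R) (m : int).

Definition dot x y : R := x.1 * y.1 + x.2 * y.2.

(* The norm `|x| of the product R * R is the sup norm. *)
Definition enorm x : R := Num.sqrt (dot x x).

Definition grad (f : R * R -> R) x : R * R := ('D_(1, 0) f x, 'D_(0, 1) f x).

Definition signed_area2 x y z : R :=
  (y.1 - x.1) * (z.2 - x.2) - (y.2 - x.2) * (z.1 - x.1).

(* A triangle is given by its vertices v 0, v 1, v 2, in either orientation;
   the edge e_i is the one opposite to v i, so that its endpoints are
   v (i + 1) and v (i - 1), with indices modulo 3. *)
Definition orient v : R := signed_area2 (v 0) (v 1) (v (- 1)).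

Definition nondegenerate_triangle v : Prop := orient v != 0.

Definition triangle v : set (R * R) :=
  [set x | exists c : 'I_3 -> R, [/\ forall i, 0 <= c i, \sum_i c i = 1 &
     x = \sum_i c i *: v i]].

Definition bary v i x : R :=
  signed_area2 x (v (i + 1)) (v (i - 1)) /
  signed_area2 (v i) (v (i + 1)) (v (i - 1)).

(* (e_i, e_(nxt i), e_(prv i)) is ordered counterclockwise. *)
Definition nxt v i : 'I_3 := if 0 < orient v then i + 1 else i - 1.
Definition prv v i : 'I_3 := if 0 < orient v then i - 1 else i + 1.

Definition edge_length v i : R := enorm (v (i - 1) - v (i + 1)).

Definition edge_integral v i (f : R * R -> R) : R :=
  edge_length v i *
  \int[lebesgue_measure]_(s in `[0, 1]) f ((1 - s) *: v (i + 1) + s *: v (i - 1)).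

Definition outward_unit_normal v i (n : R * R) : Prop :=
  [/\ enorm n = 1, dot n (v (i - 1) - v (i + 1)) = 0 &
      dot n (v i - v (i + 1)) < 0].

Definition bubble v x : R := \prod_j bary v j x.

(* b_K / lambda_i *)
Definition edge_bubble v i x : R := \prod_(j | j != i) bary v j x.

(* Polynomial functions of total degree at most m. They are taken on the whole
   plane: restriction to a nondegenerate triangle is injective on them. *)
Definition polyspace m : set (R * R -> R) :=
  [set f | match m with
    | Posz d => exists c : nat -> nat -> R, forall x,
        f x = \sum_(i < d.+1) \sum_(j < (d - i).+1) c i j * x.1 ^+ i * x.2 ^+ j
    | Negz _ => forall x, f x = 0
    end].

(* Qspace v i m is Q_i^m(K), with degree m - 1 for the test functions. *)
Definition Qspace v i m : set (R * R -> R) :=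
  [set f | polyspace m f /\ forall q, polyspace (m - 1) q ->
    \int[(lebesgue_measure \x lebesgue_measure)%E]_(x in triangle v)
      (bubble v x * edge_bubble v i x * f x * q x) = 0].

Definition bubble_space v m : set (R * R -> R) :=
  [set f | exists q : 'I_3 -> R * R -> R, (forall i, Qspace v i m (q i)) /\
    forall x, f x = bubble v x * \sum_i edge_bubble v i x * q i x].

Definition normal_dof v (n : 'I_3 -> R * R) i (k : nat) (f : R * R -> R) : R :=
  (edge_length v i)^-1 * edge_integral v i (fun x =>
    'D_(n i) f x * (jacobi 2 2 k).[bary v (nxt v i) x - bary v (prv v i) x]).

(* bary v i is affine, so its gradient may be evaluated at any point. *)
Definition shape_coef v (r : nat) i (k : nat) : R :=
  (-1) ^+ (r - k - 1) / enorm (grad (bary v i) 0) *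
  (((k + 3) * (k + 4) * (2 * k + 5))%:R /
   ((r - k - 1) * (k + 1) * (k + 2))%:R).

Lemma sum_ord3 (V : nmodType) (F : 'I_3 -> V) :
  \sum_i F i = F 0 + F 1 + F (- 1).
Proof.
rewrite !big_ord_recl big_ord0 addr0 addrA.
by congr (F _ + F _ + F _); apply: val_inj.
Qed.

Lemma ord3E :
  ((0 + 1)%R = 1%R :> 'I_3) * ((0 - 1)%R = (- 1)%R :> 'I_3) *
  ((1 + 1)%R = (- 1)%R :> 'I_3) * ((1 - 1)%R = 0%R :> 'I_3) *
  ((- 1 + 1)%R = 0%R :> 'I_3) * ((- 1 - 1)%R = 1%R :> 'I_3).
Proof. by do !split; apply: val_inj. Qed.

Lemma baryE v i x :
  bary v i x = signed_area2 x (v (i + 1)) (v (i - 1)) / orient v.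
Proof.
rewrite /bary; congr (_ / _); rewrite /orient.
have : i \in [:: 0; 1; - 1] by rewrite !inE; case: i => [[|[|[]]]].
by rewrite !inE => /or3P[] /eqP->; rewrite !ord3E /signed_area2; ring.
Qed.

Lemma bary_sum v x : nondegenerate_triangle v -> \sum_i bary v i x = 1.
Proof.
move=> o0; rewrite sum_ord3 !baryE !ord3E -!mulrDl -[RHS](divff o0).
by congr (_ / _); rewrite /orient /signed_area2; ring.
Qed.

Lemma scale_pairE (c : R) x : c *: x = (c * x.1, c * x.2).
Proof. by case: x. Qed.

Lemma bary_comb v x : nondegenerate_triangle v -> \sum_i bary v i x *: v i = x.
Proof.
rewrite /nondegenerate_triangle => o0; rewrite sum_ord3 !baryE !ord3E.
move: o0; rewrite /orient /signed_area2.
case: x (v 0) (v 1) (v (- 1)) => [x1 x2] [a1 a2] [b1 b2] [c1 c2] /= o0.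
rewrite !scale_pairE /=.
pose A := (b1 - x1) * (c2 - x2) - (b2 - x2) * (c1 - x1).
pose B := (c1 - x1) * (a2 - x2) - (c2 - x2) * (a1 - x1).
pose C := (a1 - x1) * (b2 - x2) - (a2 - x2) * (b1 - x1).
pose D := (b1 - a1) * (c2 - a2) - (b2 - a2) * (c1 - a1).
have E1 : A / D * a1 + B / D * b1 + C / D * c1 = x1 by rewrite /A /B /C /D; field.
have E2 : A / D * a2 + B / D * b2 + C / D * c2 = x2 by rewrite /A /B /C /D; field.
by rewrite -[in RHS]E1 -[in RHS]E2.
Qed.

End Triangle.

(* phi is the basis of V dual to the functionals dof. *)
Definition shape_functions (R : realType) (T : Type) (I : finType)
    (V : set (T -> R)) (dof : I -> (T -> R) -> R) (phi : I -> T -> R) : Prop :=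
  [/\ forall i, V (phi i),
      forall f, V f -> exists! c : {ffun I -> R},
        forall x, f x = \sum_i c i * phi i x &
      forall i j, dof i (phi j) = (i == j)%:R].

(* Main.v *)
Require Import Defs.
From HB Require Import structures.
From mathcomp Require Import all_boot all_order all_algebra.
From mathcomp Require Import all_classical all_reals all_analysis.
From mathcomp Require Import measurable_realfun ring lra zify.

Set Implicit Arguments.
Unset Strict Implicit.
Unset Printing Implicit Defensive.

Import Order.TTheory GRing.Theory Num.Theory.
Import numFieldNormedType.Exports.

Local Open Scope classical_set_scope.
Local Open Scope ring_scope.

(** Write m = r - 2 and, for a fixed edge e_i, s = lambda_i^+ + lambda_i^- and
    y = lambda_i^+ - lambda_i^-.

    Duality. The function b_K b_i = lambda_i (lambda_i^+ lambda_i^-)^2 vanishes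
    to second order on the two edges other than e_i, so the normal derivative of
    b_K b_i P is 0 there; on e_i it is -|grad lambda_i| (lambda_i^+
    lambda_i^-)^2 P (derive_edge).  On e_i one has s = 1 and
    lambda_i^+ lambda_i^- = (1 - y^2) / 4, and Koornwinder's polynomial becomes
    P_(m-k)^(2k+5,1)(-1) P_k^(2,2)(y).  The degrees of freedom are thus the
    scalar products of the P_k^(2,2) for their own weight (1 - y)^2 (1 + y)^2.
    These polynomials are orthogonal, and the coefficient a_(k,r-2) is what
    their norms (jacobi_norm22) and P_n^(a,1)(-1) = (-1)^n (n + 1)
    (horner_jacobi1_m1) give.  The computation is done at once for a linear
    combination (normal_dof_comb), so that it also yields linear independence.

    Membership. Koornwinder's polynomials have to be orthogonal to the
    polynomials of degree less than m for the weight b_K b_i.  No change of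
    variables in a double integral is used for this.  By Fubini's theorem on
    the slices of K, the integral over K of a partial derivative of a polynomial
    vanishing on the boundary is 0 (tri_int_pd1, tri_int_pd2), and this carries
    over to the derivatives in s and y (coord_int_pd).  Applied to a polynomial
    s^N g(y / s) phi(s), it shows that the integral of such a polynomial is 0 as
    soon as one of two integrals in one variable is 0: that of g over [-1, 1]
    (coord_int_homog_deriv), or that of s^(N+1) phi(s) over [0, 1]
    (coord_int_homog_polyint).  With the weight, the product of Koornwinder's
    polynomial and a monomial s^a y^b has this form, and if a + b < m one of
    the two integrals is 0 by the orthogonality of Jacobi polynomials
    (coord_int_weight_monom).

    Spanning. For q in Q_i^m, the restriction of q to e_i is a polynomial of
    degree at most m in y, hence a combination of the P_k^(2,2).  Subtracting the
    corresponding combination of Koornwinder's polynomials leaves an element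
    lambda_i q'' of Q_i^m with q'' of degree less than m.  Orthogonality to q''
    says that the integral of (b_K q'')^2 is 0, so q'' = 0
    (weight_poly_definite, Qspace_span). *)

(** * Integration of polynomials in one variable *)
Section Antiderivative.
Context {R : realType}.
Implicit Types (p q W : {poly R}) (a b : R).

(** The constant term is p`_0 / 0 = 0, so that one formula gives all coefficients. *)
Definition antideriv p : {poly R} := \poly_(i < (size p).+1) (p`_i.-1 / i%:R).

Lemma coef_antideriv p i : (antideriv p)`_i = p`_i.-1 / i%:R.
Proof.
rewrite coef_poly; case: ltnP => // hi.
by rewrite nth_default ?mul0r // -ltnS (leq_trans hi) // leqSpred.
Qed.

Lemma deriv_antideriv p : (antideriv p)^`() = p.
Proof.
by apply/polyP => i; rewrite coef_deriv coef_antideriv -[LHS]mulr_natr divfK.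
Qed.

Lemma antideriv_deriv p : antideriv p^`() = p - (p`_0)%:P.
Proof.
apply/polyP => -[|i]; rewrite coef_antideriv coefB coefC /= ?invr0 ?mulr0 ?subrr //.
by rewrite coef_deriv subr0 -(mulr_natr p`_i.+1) mulfK // pnatr_eq0.
Qed.

Fact antideriv_is_linear : linear antideriv.
Proof.
move=> c p q; apply/polyP => i.
by rewrite !(coefD, coefZ, coef_antideriv); ring.
Qed.
HB.instance Definition _ :=
  GRing.isLinear.Build R {poly R} {poly R} _ antideriv antideriv_is_linear.

Definition polyint a b p : R := (antideriv p).[b] - (antideriv p).[a].

Fact polyint_is_scalar a b : scalar (polyint a b).
Proof. by move=> c p q; rewrite /polyint linearP !hornerE /=; ring. Qed.
HB.instance Definition _ a b :=
  GRing.isLinear.Build R {poly R} R _ (polyint a b) (polyint_is_scalar a b).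

Lemma polyint_deriv a b p : polyint a b p^`() = p.[b] - p.[a].
Proof. by rewrite /polyint antideriv_deriv !hornerE; ring. Qed.

Lemma polyint_derivM a b p q : (p * q).[a] = 0 -> (p * q).[b] = 0 ->
  polyint a b (p^`() * q) = - polyint a b (p * q^`()).
Proof.
move=> ha hb; apply/eqP; rewrite -addr_eq0 -linearD -derivM /= polyint_deriv.
by rewrite ha hb subrr.
Qed.

Lemma polyint_derivnM a b n W q :
  (forall j, (j < n)%N -> W^`(j).[a] = 0 /\ W^`(j).[b] = 0) ->
  polyint a b (W^`(n) * q) = (-1) ^+ n * polyint a b (W * q^`(n)).
Proof.
elim: n q => [|n IH] q hW; first by rewrite !derivn0 mul1r.
have [wa wb] := hW n (leqnn _).
rewrite derivnS polyint_derivM ?hornerM ?wa ?wb ?mul0r //.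
rewrite IH -?derivSn ?exprS; first by ring.
by move=> j jn; apply: hW; rewrite ltnS ltnW.
Qed.

(** A derivative lowers the order of vanishing along U by at most one: this is why
    the boundary terms disappear when Rodrigues' formula is integrated by parts. *)
Lemma derivn_expM (U V : {poly R}) n j :
  exists W : {poly R}, (U ^+ n * V)^`(j) = U ^+ (n - j) * W.
Proof.
elim: j => [|j [W hW]]; first by exists V; rewrite derivn0 subn0.
rewrite derivnS hW derivM deriv_exp subnS.
case: (n - j)%N => [|m]; first by exists W^`(); rewrite /= !mulr0n mul0r add0r.
exists ((U^`() *+ m.+1) * W + U * W^`()) => /=; rewrite exprS.
by ring.
Qed.

Lemma size_polyM_leS p q m n : (size p <= m.+1)%N -> (size q <= n.+1)%N ->
  (size (p * q)%R <= (m + n).+1)%N.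
Proof.
move=> sp sq; rewrite (leq_trans (size_polyMleq _ _)) //.
by move: (leq_add sp sq); lia.
Qed.

Lemma size_exp_le2 p m : (size p <= 2)%N -> (size (p ^+ m)%R <= m.+1)%N.
Proof. by move=> sp; rewrite (leq_trans (size_poly_exp_leq _ _)) //; nia. Qed.

Lemma size_1subX : (size (1 - 'X : {poly R})%R <= 2)%N.
Proof.
by rewrite (leq_trans (size_polyD _ _)) // size_polyN size_polyX size_poly1.
Qed.

Lemma size_1addX : (size (1 + 'X : {poly R})%R <= 2)%N.
Proof. by rewrite (leq_trans (size_polyD _ _)) // size_polyX size_poly1. Qed.

Lemma coef_topM p q m n : (size p <= m.+1)%N -> (size q <= n.+1)%N ->
  (p * q)`_(m + n) = p`_m * q`_n.
Proof.
move=> sp sq; rewrite coefM (bigD1 (inord m)) //= inordK ?ltnS ?leq_addr //.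
rewrite addKn big1 ?addr0 // => i; rewrite -val_eqE /= inordK ?ltnS ?leq_addr //.
move=> im; case: (ltngtP i m) im => // im _.
  by rewrite [q`__]nth_default ?mulr0 // (leq_trans sq) //; lia.
by rewrite nth_default ?mul0r // (leq_trans sp).
Qed.

End Antiderivative.

(** * Jacobi polynomials with natural exponents *)
Section JacobiNat.
Context {R : realType}.
Implicit Types (a b n k : nat).

Definition jacobi_weight a b : {poly R} := (1 - 'X) ^+ a * (1 + 'X) ^+ b.

Lemma jacobi_weightE a b t : (jacobi_weight a b).[t] = (1 - t) ^+ a * (1 + t) ^+ b.
Proof. by rewrite /jacobi_weight !hornerE. Qed.

(** The hypothesis bounds t because powR agrees with a polynomial only at
    nonnegative bases; the interval is open, so derivatives are determined. *)
Lemma derive1n_horner_near n (f : R -> R) (p : {poly R}) :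
  (forall t, -1 < t < 1 -> f t = p.[t]) ->
  forall t, -1 < t < 1 -> derive1n n f t = p^`(n).[t].
Proof.
move=> hf; elim: n => [|n IH] t ht; first by rewrite derive1n0 derivn0 hf.
have nt : \forall s \near t, derive1n n f s = p^`(n).[s].
  have tI : t \in `](-1), 1[ by rewrite in_itv.
  near=> s; apply: IH.
  have : s \in `](-1), 1[ by near: s; exact: near_in_itvoo.
  by rewrite in_itv.
rewrite derive1nS derive1E (near_eq_derive _ nt) derivnS.
by have := is_derive_poly p^`(n) t; case.
Unshelve. all: by end_near. Qed.

Lemma poly_eq_itv (p q : {poly R}) (a b : R) : a < b ->
  (forall t, a < t < b -> p.[t] = q.[t]) -> p = q.
Proof.
move=> ab hpq; apply/eqP; rewrite -subr_eq0; apply/eqP.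
pose u (k : nat) : R := a + (b - a) / k.+2%:R.
have d0 : 0 < b - a by rewrite subr_gt0.
apply: (@roots_geq_poly_eq0 _ _ [seq u k | k <- iota 0 (size (p - q))]).
- apply/allP => _ /mapP[k _ ->]; rewrite rootE hornerD hornerN subr_eq0.
  apply/eqP/hpq; rewrite ltrDl divr_gt0 //= -ltrBrDl.
  by rewrite ltr_pdivrMr // ltr_pMr // ltr1n.
- rewrite map_inj_uniq ?iota_uniq // => i j /addrI /mulfI.
  by rewrite gt_eqF // => /(_ isT) /invr_inj /eqP; rewrite eqr_nat => /eqP[].
- by rewrite size_map size_iota.
Qed.

Definition rodrigues_coef n : R := (-1) ^+ n / (2 ^+ n * n`!%:R).

(** Rodrigues' formula compares real powers on ]-1, 1[; there, for natural
    exponents, both sides are polynomials. *)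
Lemma jacobi_rodrigues a b n :
  jacobi_weight a b * jacobi a%:R b%:R n = rodrigues_coef n *: (jacobi_weight (n + a)
    (n + b))^`(n).
Proof.
apply: (@poly_eq_itv _ _ (-1) 1); first lra.
move=> t ht; have := jacobiP a%:R b%:R n ht.
have y0 (s : R) : -1 < s < 1 -> 0 <= 1 - s by lra.
have z0 (s : R) : -1 < s < 1 -> 0 <= 1 + s by lra.
rewrite !powR_mulrn ?y0 ?z0 // hornerM hornerZ jacobi_weightE => ->.
congr (_ * _); apply: derive1n_horner_near => // s hs.
by rewrite jacobi_weightE -!natrD !powR_mulrn ?y0 ?z0.
Qed.

Lemma derivn_jacobi_weight_pm1 a b n j : (j < n)%N ->
  (jacobi_weight (n + a) (n + b))^`(j).[-1] = 0 /\ (jacobi_weight (n + a) (n +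
    b))^`(j).[1] = 0.
Proof.
move=> jn; split.
  rewrite /jacobi_weight mulrC; have [W ->] := derivn_expM (1 + 'X : {poly R}) ((1 -
    'X) ^+ (n + a)) (n + b) j.
  by rewrite !hornerE subrr expr0n subn_eq0 leqNgt (leq_trans jn) ?leq_addr // mul0r.
have [W ->] := derivn_expM (1 - 'X : {poly R}) ((1 + 'X) ^+ (n + b)) (n + a) j.
by rewrite !hornerE subrr expr0n subn_eq0 leqNgt (leq_trans jn) ?leq_addr // mul0r.
Qed.

(** Integration by parts n times in Rodrigues' formula. *)
Lemma polyint_jacobiM a b n (q : {poly R}) :
  polyint (-1) 1 (jacobi_weight a b * jacobi a%:R b%:R n * q) =
  rodrigues_coef n * (-1) ^+ n * polyint (-1) 1 (jacobi_weight (n + a) (n + b) * q^`(n)).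
Proof.
rewrite jacobi_rodrigues -scalerAl linearZ /=.
rewrite polyint_derivnM ?mulrA // => j jn; exact: derivn_jacobi_weight_pm1.
Qed.

Lemma jacobi_orthogonal a b n (q : {poly R}) : (size q <= n)%N ->
  polyint (-1) 1 (jacobi_weight a b * jacobi a%:R b%:R n * q) = 0.
Proof. by move=> sq; rewrite polyint_jacobiM derivn_poly0 // mulr0 linear0 mulr0. Qed.

Lemma size_jacobi_weight a b : (size (jacobi_weight a b) <= (a + b).+1)%N.
Proof.
by rewrite size_polyM_leS // size_exp_le2 ?size_1subX ?size_1addX.
Qed.

Lemma coef_exp_top (p : {poly R}) m : (size p <= 2)%N -> (p ^+ m)`_m = p`_1 ^+ m.
Proof.
move=> sp; elim: m => [|m IH]; first by rewrite !expr0 coef1.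
by rewrite !exprS -add1n coef_topM ?IH // size_exp_le2.
Qed.

Lemma coef_jacobi_weight a b : (jacobi_weight a b)`_(a + b) = (-1) ^+ a.
Proof.
rewrite coef_topM ?size_exp_le2 ?size_1subX ?size_1addX //.
rewrite !coef_exp_top ?size_1subX ?size_1addX // coefB coefD !coefX coef1 /=.
by rewrite sub0r add0r expr1n mulr1.
Qed.

Lemma rodrigues_coef_sign n : rodrigues_coef n * (-1) ^+ n = (2 ^+ n * n`!%:R)^-1.
Proof. by rewrite /rodrigues_coef mulrAC -exprMn mulrNN mulr1 expr1n mul1r. Qed.

(** Comparison of the leading coefficients in Rodrigues' formula. *)
Lemma coef_jacobi a b n :
  (jacobi a%:R b%:R n : {poly R})`_n = ((n + (n + a + b)) ^_ n)%:R / (2 ^+ n * n`!%:R).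
Proof.
have := congr1 (fun p : {poly R} => p`_(a + b + n)) (jacobi_rodrigues a b n).
rewrite coef_topM ?size_jacobi_weight ?size_jacobi // coef_jacobi_weight coefZ
  coef_derivn.
have -> : (n + (a + b + n) = (n + a) + (n + b))%N by lia.
rewrite coef_jacobi_weight exprD => /(congr1 (fun x => (-1) ^+ a * x)).
rewrite mulrA -exprMn mulrNN mulr1 expr1n mul1r => ->.
have -> : ((n + a) + (n + b) = n + (n + a + b))%N by lia.
have sq : (-1) ^+ a * (-1) ^+ a = 1 :> R by rewrite -exprMn mulrNN mulr1 expr1n.
rewrite -rodrigues_coef_sign -(mulr_natr (_ * _)) -[RHS]mul1r -[X in _ = X * _]sq; ring.
Qed.

Lemma coef_jacobi_neq0 a b n : (jacobi a%:R b%:R n : {poly R})`_n != 0.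
Proof.
rewrite coef_jacobi mulf_neq0 ?invr_eq0 ?mulf_neq0 ?expf_neq0 ?pnatr_eq0 //.
  by rewrite -lt0n ffact_gt0 -addnA leq_addr.
by rewrite -lt0n fact_gt0.
Qed.

(** The Beta integral. The recurrence on the exponents expresses that the
    derivative of (1 - t)^(a+1) (1 + t)^(b+1) has integral 0. *)
Lemma polyint_jacobi_weight a b :
  polyint (-1) 1 (jacobi_weight a b) = 2 ^+ (a + b).+1 * a`!%:R * b`!%:R / ((a +
    b).+1)`!%:R.
Proof.
elim: b a => [|b IH] a.
  have -> : jacobi_weight a 0 = (- (a.+1%:R)^-1) *: ((1 - 'X) ^+ a.+1)^`().
    rewrite /jacobi_weight expr0 mulr1 deriv_exp derivB derivX -polyC1 derivC /=.
    rewrite sub0r mulN1r -(scaler_nat a.+1 (- _)) !scalerN scaleNr opprK scalerA.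
    by rewrite mulVf ?scale1r // pnatr_eq0.
  rewrite linearZ /= polyint_deriv !hornerE subrr expr0n /= opprK ?addn0.
  rewrite factS natrM -[1 + 1]/(2 : R) sub0r mulrNN.
  have f0 : (a`!%:R : R) != 0 by rewrite pnatr_eq0 -lt0n fact_gt0.
  have a0 : (a.+1%:R : R) != 0 by rewrite pnatr_eq0.
  by move: a0; move: (a.+1%:R : R) => c a0; field; rewrite f0 a0.
have h : a.+1%:R * polyint (-1) 1 (jacobi_weight a b.+1) = b.+1%:R * polyint (-1) 1
  (jacobi_weight a.+1 b).
  apply/eqP; rewrite -subr_eq0 -oppr_eq0 opprB.
  rewrite -!linearZ /= -linearB /=.
  have -> : b.+1%:R *: jacobi_weight a.+1 b - a.+1%:R *: jacobi_weight a b.+1 =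
    (jacobi_weight a.+1 b.+1)^`().
    rewrite /jacobi_weight derivM !deriv_exp derivB derivD derivX -polyC1 !derivC /=.
    rewrite -!mul_polyC !polyC_natr; ring.
  by rewrite polyint_deriv !jacobi_weightE !subrr !expr0n /= !(mul0r, mulr0) subrr.
have a0 : (a.+1%:R : R) != 0 by rewrite pnatr_eq0.
apply: (mulfI a0); rewrite h IH addSnnS.
rewrite (factS a) (factS b) !natrM; ring.
Qed.

(** In polyint_jacobiM with q the Jacobi polynomial itself, the n-th derivative is
    the constant n! times the leading coefficient, which leaves a Beta integral. *)
Lemma jacobi_norm22 k :
  polyint (-1) 1 (jacobi_weight 2 2 * jacobi 2 2 k * jacobi 2 2 k) =
  32 * ((k + 1) * (k + 2))%:R / ((k + 3) * (k + 4) * (2 * k + 5))%:R.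
Proof.
have := polyint_jacobiM 2 2 k (jacobi 2 2 k) => ->.
have -> : (jacobi 2 2 k)^`(k) = (k`!%:R * (jacobi 2 2 k : {poly R})`_k)%:P.
  apply/polyP => -[|i]; rewrite coef_derivn coefC /=.
    by rewrite addn0 ffactnn mulr_natl.
  by rewrite nth_default ?mul0rn // (leq_trans (size_jacobi _ _ _)) // addnS leq_addr.
rewrite [_ * _%:P]mulrC mul_polyC linearZ /= polyint_jacobi_weight (coef_jacobi 2 2)
  rodrigues_coef_sign.
have -> : ((k + (k + 2 + 2)) ^_ k)%:R = (k + (k + 2 + 2))`!%:R / (k + 4)`!%:R :> R.
  have := ffact_fact (leq_addr (k + 2 + 2) k); rewrite addKn => <-.
  rewrite natrM -addnA mulfK // pnatr_eq0 -lt0n fact_gt0 //.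
have -> : (k + (k + 2 + 2) = k + 2 + (k + 2))%N by lia.
rewrite factS; set F := (k + 2 + (k + 2))`!.
have F0 : (F%:R : R) != 0 by rewrite pnatr_eq0 -lt0n fact_gt0.
rewrite (_ : (k + 4)`! = ((k + 4) * (k + 3) * (k + 2)`!)%N); last first.
  by rewrite !addnS addn0 !factS; lia.
rewrite (_ : (k + 2)`! = ((k + 2) * (k + 1) * k`!)%N); last first.
  by rewrite !addnS addn0 !factS; lia.
have f0 : (k`!%:R : R) != 0 by rewrite pnatr_eq0 -lt0n fact_gt0.
have p0 : (2 : R) ^+ k != 0 by rewrite expf_neq0 // pnatr_eq0.
rewrite (_ : (k + 2 + (k + 2)).+1 = (k + k + 5)%N); last by lia.
rewrite exprD exprD !natrM !natrD.
have k0 : (0 : R) <= k%:R by rewrite ler0n.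
field.
rewrite f0 F0 p0 /=.
by rewrite !andbA; do ?[apply/andP; split]; rewrite gt_eqF //; lra.
Qed.

(** Leibniz' rule modulo one more factor 1 + 'X: the term kept is the one that
    survives at -1. *)
Lemma derivn_exp_shift (V : {poly R}) n j : (j <= n)%N -> exists W : {poly R},
  ((1 + 'X) ^+ n * V)^`(j) =
  (1 + 'X) ^+ (n - j) * ((n ^_ j)%:R *: V + (1 + 'X) * W).
Proof.
elim: j => [|j IH] jn.
  by exists 0; rewrite derivn0 subn0 ffactn0 scale1r mulr0 addr0.
have [W hW] := IH (ltnW jn).
exists ((n ^_ j)%:R *: V^`() + W + (1 + 'X) * W^`() + W *+ (n - j)).
rewrite derivnS hW -(subnSK jn) derivM deriv_exp /= !(derivD, derivM, derivZ, derivX).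
rewrite -polyC1 derivC ffactnSr -(subnSK jn) exprS natrM.
by rewrite -!mul_polyC polyCM !polyC_natr; ring.
Qed.

(** Both sides of Rodrigues' formula contain the factor 1 + t exactly once; after
    division by it, the formula can be evaluated at -1. *)
Lemma horner_jacobi1_m1 a n : (jacobi a%:R 1%:R n : {poly R}).[-1] = (-1) ^+ n * n.+1%:R.
Proof.
have := jacobi_rodrigues a 1 n.
have [W hW] := derivn_exp_shift ((1 - 'X) ^+ (n + a)) (leqnSn n).
rewrite /jacobi_weight [in RHS]mulrC addn1 hW subSnn !expr1.
have n0 : (1 + 'X : {poly R}) != 0.
  by apply/eqP => /(congr1 (horner^~ 0)) /eqP; rewrite !hornerE oner_eq0.
rewrite scalerAr [_ * (1 + 'X)]mulrC -mulrA => /(mulfI n0) /(congr1 (horner^~ (-1))).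
rewrite !hornerE subrr mul0r addr0 opprK -[1 + 1]/2 => h.
have p0 m : (2 : R) ^+ m != 0 by rewrite expf_neq0 // pnatr_eq0.
apply: (mulfI (p0 a)); rewrite h /rodrigues_coef exprD.
rewrite ffact_prod.
have -> : (\prod_(i < n) (n.+1 - i) = n.+1 * n`!)%N.
  by rewrite -ffact_prod -factS -(ffactnn n.+1) ffactnSr subSnn muln1.
have f0 : (n`!%:R : R) != 0 by rewrite pnatr_eq0 -lt0n fact_gt0.
rewrite natrM; field; rewrite f0 p0 //.
Qed.

End JacobiNat.

(** * Polynomials in two variables *)
Section Bivariate.
Context {R : realType}.
Implicit Types (p q : {poly {poly R}}) (x : R * R).

(** A polynomial in two variables is a polynomial over {poly R}: the outer variable
    is the first coordinate, the inner one the second. *)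
Definition ev2 p x : R := p.[x.1%:P].[x.2].
Definition pd1 p : {poly {poly R}} := p^`().
Definition pd2 p : {poly {poly R}} := map_poly (@deriv R) p.

Lemma ev2_cons p (c : {poly R}) x : ev2 (p * 'X + c%:P) x = ev2 p x * x.1 + c.[x.2].
Proof. by rewrite /ev2 !hornerE. Qed.

Lemma ev2D p q x : ev2 (p + q) x = ev2 p x + ev2 q x.
Proof. by rewrite /ev2 !hornerE. Qed.

Lemma ev2M p q x : ev2 (p * q) x = ev2 p x * ev2 q x.
Proof. by rewrite /ev2 !hornerE. Qed.

Lemma ev2Z (a : R) p x : ev2 (a%:P *: p) x = a * ev2 p x.
Proof. by rewrite /ev2 !hornerE. Qed.

Lemma ev2_slice1 p (s t : R) : ev2 p (t, s) = (map_poly (horner_eval s) p).[t].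
Proof. by have := horner_map (horner_eval s) p t%:P; rewrite /= {2}/horner_eval hornerC
  => ->. Qed.

Lemma deriv_slice1 p (s : R) :
  (map_poly (horner_eval s) p)^`() = map_poly (horner_eval s) (pd1 p).
Proof. exact: deriv_map. Qed.

Lemma pd2_cons p (c : {poly R}) : pd2 (p * 'X + c%:P) = pd2 p * 'X + (c^`())%:P.
Proof.
apply/polyP => i; rewrite /pd2 coef_map_id0 ?deriv0 // !coefD !coefMX !coefC.
rewrite derivD; case: i => [|i] /=; first by rewrite deriv0.
by rewrite deriv0 addr0 coef_map_id0 ?deriv0 // addr0.
Qed.

Lemma pd2_monom (c : {poly R}) n : pd2 (c%:P * 'X^n) = (c^`())%:P * 'X^n.
Proof.
apply/polyP => a; rewrite /pd2 coef_map_id0 ?deriv0 // !coefCM !coefXn.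
by case: eqP => _; rewrite ?mulr1 ?mulr0 ?deriv0.
Qed.

Lemma pd2D p q : pd2 (p + q) = pd2 p + pd2 q.
Proof. by rewrite /pd2 raddfD. Qed.

Lemma pd2M p q : pd2 (p * q) = pd2 p * q + p * pd2 q.
Proof.
apply/polyP => a; rewrite coefD !coefM /pd2 coef_map_id0 ?deriv0 // coefM.
rewrite -big_split raddf_sum /=; apply: eq_bigr => i _.
by rewrite derivM !coef_map_id0 ?deriv0.
Qed.

Lemma pd2_0 : pd2 0 = 0. Proof. exact: map_poly0. Qed.

Lemma deriv_slice2 p (t : R) : (p.[t%:P])^`() = (pd2 p).[t%:P].
Proof.
elim/poly_ind: p => [|p c IH]; first by rewrite /pd2 map_poly0 !horner0 deriv0.
rewrite pd2_cons hornerMXaddC derivD derivM derivC mulr0 addr0 IH.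
by rewrite hornerD hornerM hornerX hornerC /= addrC.
Qed.

Lemma measurable_ev2 p : measurable_fun [set: R * R] (ev2 p).
Proof.
elim/poly_ind: p => [|p c IH].
  by rewrite (_ : ev2 0 = cst 0) //; apply/funext => x; rewrite /ev2 !horner0.
rewrite (_ : ev2 _ = (fun x => ev2 p x * x.1 + c.[x.2])); last first.
  by apply/funext => x; rewrite ev2_cons.
apply: measurable_funD; first exact: measurable_funM.
apply: (measurableT_comp (f := horner c) (g := snd)); last exact: measurable_snd.
by apply: continuous_measurable_fun; exact: continuous_horner.
Qed.

Lemma continuous_ev2 p : continuous (ev2 p).
Proof.
elim/poly_ind: p => [|p c IH].
  rewrite (_ : ev2 0 = cst 0); first exact: cst_continuous.
  by apply/funext => x; rewrite /ev2 !horner0.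
rewrite (_ : ev2 _ = (fun x => ev2 p x * x.1 + c.[x.2])); last first.
  by apply/funext => x; rewrite ev2_cons.
move=> x; apply: cvgD; first by apply: cvgM; [exact: IH | exact: cvg_fst].
by apply: (@continuous_comp _ _ _ snd (horner c)); [exact: cvg_snd | exact:
  continuous_horner].
Qed.

Lemma horner_bounded (c : {poly R}) (M : R) :
  exists C, forall t, `|t| <= M -> `|c.[t]| <= C.
Proof.
elim/poly_ind: c => [|p c [C IH]]; first by exists 0 => t _; rewrite horner0 normr0.
exists (C * M + `|c|) => t ht; rewrite !hornerE (le_trans (ler_normD _ _)) // lerD2r.
by rewrite normrM ler_pM // IH.
Qed.

Lemma ev2_bounded p (M : R) :
  exists C, forall x, `|x.1| <= M -> `|x.2| <= M -> `|ev2 p x| <= C.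
Proof.
elim/poly_ind: p => [|p c [C IH]].
  by exists 0 => t _ _; rewrite /ev2 !horner0 normr0.
have [D hD] := horner_bounded c M.
exists (C * M + D) => x h1 h2; rewrite ev2_cons (le_trans (ler_normD _ _)) //.
by rewrite lerD ?hD // normrM ler_pM // IH.
Qed.

End Bivariate.

(** * Integration over slices *)
Section Slice.
Context {R : realType}.
Notation mu := (@lebesgue_measure R).

Lemma integral_deriv_poly (F : {poly R}) (a b : R) : a <= b ->
  (\int[mu]_(t in `[a, b]) (F^`().[t])%:E)%E = (F.[b] - F.[a])%:E.
Proof.
rewrite le_eqVlt => /predU1P[<-|ab].
  by rewrite set_itv1 integral_set1 subrr.
rewrite EFinB; apply: continuous_FTC2 => //.
- exact/continuous_subspaceT/continuous_horner.
- split; first by move=> t _; exact: derivable_horner.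
  + apply: cvg_at_right_filter; exact: continuous_horner.
  + apply: cvg_at_left_filter; exact: continuous_horner.
- by move=> t _; rewrite -derivE.
Qed.

(** The slice A is a segment, being bounded, closed and convex.  At an endpoint one
    of the affine functions vanishes, otherwise A would extend further; hence F
    vanishes at both endpoints. *)
Lemma integral_slice (al be : 'I_3 -> R) (F : {poly R}) (M : R) :
  let A := [set t | forall i, 0 <= al i * t + be i] in
  (forall t, A t -> `|t| <= M) ->
  (forall t, \prod_i (al i * t + be i) = 0 -> F.[t] = 0) ->
  (\int[mu]_(t in A) (F^`().[t])%:E)%E = 0%E.
Proof.
move=> A AM hF.
have [A0|/set0P A0] := eqVneq A set0; first by rewrite A0 integral_set0.
have cl i : continuous (fun t : R => al i * t + be i).
  move=> t; apply: cvgD; last exact: cvg_cst.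
  by apply: cvgM; [exact: cvg_cst | exact: cvg_id].
have cA : compact A.
  apply: (@subclosed_compact _ _ `[- M, M]); last 2 first.
  - exact: segment_compact.
  - by move=> t /AM /=; rewrite in_itv /= ler_norml.
  have -> : A = \bigcap_i ((fun t : R => al i * t + be i) @^-1` [set s | 0 <= s]).
    by apply/seteqP; split => [t ht i _|t ht i]; [exact: ht | exact: (ht i)].
  apply: closed_bigI => i _; apply: preimage_closed; last exact: closed_ge.
  by move=> t _; exact: cl.
have cid : {within A, continuous (id : R -> R)}.
  apply: continuous_subspaceT => t; exact: cvg_id.
have [b] := compact_EVT_max A0 cA cid; rewrite inE => Ab bmax.
have [a] := compact_EVT_min A0 cA cid; rewrite inE => Aa amin.
have ab : a <= b by apply: amin; rewrite inE.
have AE : A = `[a, b]%classic.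
  apply/seteqP; split => t /=; rewrite in_itv /=.
    by move=> At; rewrite amin ?inE // bmax ?inE.
  move=> /andP[at_ tb] i; have := Aa i; have := Ab i.
  by move: (al i) (be i) => c d; have [c0|c0] := leP 0 c; nra.
have int0 c : A c -> \prod_i (al i * c + be i) != 0 -> \forall t \near c, A t.
  move=> Ac /prodf_neq0 c0; apply: (@filter_forall R _ (fun i t => is_true (0 <= al i *
    t + be i)) (nbhs c)) => i.
  have lt0 : 0 < al i * c + be i by rewrite lt_def c0 //= Ac.
  have : \forall t \near c, 0 < al i * t + be i by apply: (cvgr_gt _ (cl i c)).
  by apply: filterS => t /ltW.
have Fb : F.[b] = 0.
  apply: hF; apply/eqP/negP => /negP /(int0 _ Ab) nA.
  have nA' : \forall t \near b^'+, A t by apply: cvg_within.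
  have : \forall t \near b^'+, b < t by exact: nbhs_right_gt.
  move/(filterI nA') => /filter_ex [t [At]].
  by rewrite ltNge => /negP; apply; apply: bmax; rewrite inE.
have Fa : F.[a] = 0.
  apply: hF; apply/eqP/negP => /negP /(int0 _ Aa) nA.
  have nA' : \forall t \near a^'-, A t by apply: cvg_within.
  have : \forall t \near a^'-, t < a by exact: nbhs_left_lt.
  move/(filterI nA') => /filter_ex [t [At]].
  by rewrite ltNge => /negP; apply; apply: amin; rewrite inE.
by rewrite AE integral_deriv_poly // Fa Fb subrr.
Qed.

End Slice.

(** * Integration over the triangle *)
Section TriangleIntegral.
Context {R : realType}.
Variable (v : 'I_3 -> R * R).
Hypothesis hv : nondegenerate_triangle v.
Notation mu := (@lebesgue_measure R).
Notation mu2 := (mu \x mu)%E.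
Implicit Types (p q : {poly {poly R}}) (i : 'I_3).

Definition bary_dx i : R := ((v (i + 1)).2 - (v (i - 1)).2) / orient v.
Definition bary_dy i : R := ((v (i - 1)).1 - (v (i + 1)).1) / orient v.
Definition bary_c i : R := bary v i (0, 0).

Lemma bary_affine i x : bary v i x = bary_dx i * x.1 + bary_dy i * x.2 + bary_c i.
Proof.
have h := hv; rewrite /nondegenerate_triangle in h.
by rewrite /bary_c !baryE /bary_dx /bary_dy /signed_area2 /=; field.
Qed.

Definition bary_poly i : {poly {poly R}} :=
  (bary_dx i)%:P%:P * 'X + (bary_dy i *: 'X + (bary_c i)%:P)%:P.

Lemma ev2_bary i x : ev2 (bary_poly i) x = bary v i x.
Proof. by rewrite /bary_poly ev2_cons bary_affine /ev2 !hornerE /=; ring. Qed.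

Lemma ord3_cases (P : 'I_3 -> Prop) : P 0 -> P 1 -> P (- 1) -> forall i, P i.
Proof.
move=> h0 h1 h2 i; have : i \in [:: 0; 1; - 1] by rewrite !inE; case: i => [[|[|[]]]].
by rewrite !inE => /or3P[] /eqP->.
Qed.

Lemma bary_barycenter (c : 'I_3 -> R) i : \sum_i c i = 1 ->
  bary v i (\sum_i c i *: v i) = c i.
Proof.
have := hv; rewrite /nondegenerate_triangle.
move=> o0; rewrite !sum_ord3 baryE; move: o0.
rewrite /orient /signed_area2; move: i; apply: ord3_cases;
  rewrite !ord3E !scale_pairE /=;
  case: (v 0) (v 1) (v (- 1)) => [a1 a2] [b1 b2] [c1 c2] /= o0 hc.
- have -> : c 0 = 1 - c 1 - c (- 1) by rewrite -hc; ring.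
  by field.
- have -> : c 0 = 1 - c 1 - c (- 1) by rewrite -hc; ring.
  by field.
- have -> : c 0 = 1 - c 1 - c (- 1) by rewrite -hc; ring.
  by field.
Qed.

Lemma triangleE : triangle v = [set x | forall i, 0 <= bary v i x].
Proof.
apply/seteqP; split => x /=.
  by move=> [c [c0 c1 ->]] i; rewrite bary_barycenter.
move=> h; exists (fun i => bary v i x); split => //.
- exact: bary_sum.
- by rewrite bary_comb.
Qed.

Definition tri_bound : R := \sum_i (`|(v i).1| + `|(v i).2|).

Lemma triangle_bounded x : triangle v x -> `|x.1| <= tri_bound /\ `|x.2| <= tri_bound.
Proof.
rewrite triangleE /= => h.
have h1 i : bary v i x <= 1.
  rewrite -(bary_sum x hv) (bigD1 i) //= lerDl sumr_ge0 // => j _; exact: h.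
have key (d : R) i : `|bary v i x * d| <= `|d|.
  by rewrite normrM ger0_norm // ler_piMl.
have e := bary_comb x hv; rewrite -[X in `|X.1| <= _]e -[X in `|X.2| <= _]e.
rewrite /tri_bound !sum_ord3 !scale_pairE /=.
have ab (a b : R) : `|a| <= `|a| + `|b| by rewrite lerDl.
have ba (a b : R) : `|b| <= `|a| + `|b| by rewrite lerDr.
split; apply: (le_trans (ler_normD _ _)); apply: lerD;
  rewrite ?(le_trans (key _ _)) //;
  apply: (le_trans (ler_normD _ _)); apply: lerD; rewrite (le_trans (key _ _)) //.
Qed.

Lemma measurable_triangle : measurable (triangle v).
Proof.
have -> : triangle v = \bigcap_i (bary v i @^-1` `[0, +oo[).
  rewrite triangleE; apply/seteqP; split => [x hx i _|x hx i] /=.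
    by rewrite in_itv /= andbT.
  by have := hx i I; rewrite /= in_itv /= andbT.
apply: fin_bigcap_measurable => [|i _]; first exact: finite_finset.
rewrite -[X in measurable X]setTI.
rewrite (_ : bary v i = ev2 (bary_poly i)); last by apply/funext => x; rewrite ev2_bary.
by apply: measurable_ev2 => //; exact: measurable_itv.
Qed.

Lemma triangle_finite_measure : (mu2 (triangle v) < +oo)%E.
Proof.
pose B : set (R * R) := `[- tri_bound, tri_bound] `*` `[- tri_bound, tri_bound].
have sub : triangle v `<=` B.
  by move=> x /triangle_bounded[h1 h2]; split; rewrite /= in_itv /= -ler_norml.
apply: (@le_lt_trans _ _ (mu2 B)).
  apply: le_measure => //; rewrite inE; first exact: measurable_triangle.
  by apply: measurableX; exact: measurable_itv.
rewrite product_measure1E; [|exact: measurable_itv..].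
by rewrite /= lebesgue_measure_itv /=; case: ifPn => _; rewrite ?mule0 // -EFinB -EFinM
  ltry.
Qed.

Lemma integrable_ev2 p : mu2.-integrable (triangle v) (EFin \o ev2 p).
Proof.
apply: measurable_bounded_integrable.
- exact: measurable_triangle.
- exact: triangle_finite_measure.
- by apply: measurable_funTS; exact: measurable_ev2.
- have [C hC] := ev2_bounded p tri_bound.
  exists C; split; first exact: num_real.
  move=> D CD x Kx; have [h1 h2] := triangle_bounded Kx.
  by apply: le_trans (hC _ h1 h2) (ltW CD).
Qed.

Lemma integrable_ev2_patch p :
  mu2.-integrable setT ((EFin \o ev2 p) \_ (triangle v)).
Proof.
exact: (proj1 (@integrable_mkcond _ _ _ mu2 (triangle v) (EFin \o ev2 p)
  measurable_triangle) (integrable_ev2 p)).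
Qed.

Definition tri_int p : R := \int[mu2]_(x in triangle v) ev2 p x.

Lemma tri_intD p q : tri_int (p + q) = tri_int p + tri_int q.
Proof.
rewrite /tri_int -RintegralD; [|exact: measurable_triangle|exact: integrable_ev2..].
by apply: eq_Rintegral => x _; rewrite /ev2 !hornerE.
Qed.

Lemma tri_intZ (a : R) p : tri_int (a%:P *: p) = a * tri_int p.
Proof.
rewrite /tri_int -RintegralZl; [|exact: measurable_triangle|exact: integrable_ev2..].
by apply: eq_Rintegral => x _; rewrite /ev2 !hornerE.
Qed.

(** The inner integral of Fubini's theorem runs over a slice of the triangle, where
    the fundamental theorem of calculus leaves boundary values of p only. *)
Lemma tri_int_pd1 p : (forall x, bubble v x = 0 -> ev2 p x = 0) -> tri_int (pd1 p) = 0.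
Proof.
move=> hp; rewrite /tri_int /Rintegral.
rewrite integral_mkcond -integral21_prod_meas1; last first.
  exact: (integrable_ev2_patch (pd1 p)).
rewrite integral0_eq // => s _; rewrite /fubini_G.
pose be i := bary_dy i * s + bary_c i.
rewrite -[RHS](@integral_slice R bary_dx be (map_poly (horner_eval s) p) tri_bound).
- rewrite [RHS]integral_mkcond; apply: eq_integral => t _; rewrite !patchE.
  have -> : ((t, s) \in triangle v) =
      (t \in [set t0 | forall i, 0 <= bary_dx i * t0 + be i]).
    rewrite triangleE; apply/idP/idP; rewrite !inE /= => h i; have := h i;
    by rewrite bary_affine /be addrA.
  by case: ifP => // _; rewrite deriv_slice1 -ev2_slice1.
- move=> t ht; apply: (proj1 (@triangle_bounded (t, s) _)).
  by rewrite triangleE /= => i; rewrite bary_affine -addrA; apply: ht.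
- move=> t ht; rewrite -ev2_slice1; apply: hp; rewrite -[RHS]ht.
  by apply: eq_bigr => i _; rewrite bary_affine /be addrA.
Qed.

Lemma tri_int_pd2 p : (forall x, bubble v x = 0 -> ev2 p x = 0) -> tri_int (pd2 p) = 0.
Proof.
move=> hp; rewrite /tri_int /Rintegral.
rewrite integral_mkcond -integral12_prod_meas1; last first.
  exact: (integrable_ev2_patch (pd2 p)).
rewrite integral0_eq // => s _; rewrite /fubini_F.
pose be i := bary_dx i * s + bary_c i.
rewrite -[RHS](@integral_slice R bary_dy be p.[s%:P] tri_bound).
- rewrite [RHS]integral_mkcond; apply: eq_integral => t _; rewrite !patchE.
  have -> : ((s, t) \in triangle v) =
      (t \in [set t0 | forall i, 0 <= bary_dy i * t0 + be i]).
    rewrite triangleE; apply/idP/idP; rewrite !inE /= => h i; have := h i;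
    by rewrite bary_affine /be addrCA addrA.
  by case: ifP => // _; rewrite deriv_slice2.
- move=> t ht; apply: (proj2 (@triangle_bounded (s, t) _)).
  by rewrite triangleE /= => i; rewrite bary_affine -addrA addrCA; apply: ht.
- move=> t ht; apply: (hp (s, t)); rewrite -[RHS]ht.
  by apply: eq_bigr => i _; rewrite bary_affine /be addrCA addrA.
Qed.

(** If p did not vanish at an interior point, it would be nonzero on a box around
    it, which has positive measure; but p is 0 almost everywhere. *)
Lemma tri_int_eq0 p : (forall x, triangle v x -> 0 <= ev2 p x) -> tri_int p = 0 ->
  forall x, (forall i, 0 < bary v i x) -> ev2 p x = 0.
Proof.
move=> p0 Ip x hx; apply/eqP/negP => /negP px.
have Kx : triangle v x by rewrite triangleE => i; exact: ltW.
have ae : ae_eq mu2 (triangle v) (EFin \o ev2 p) (cst 0%E).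
  apply/ae_eq_integral_abs; first exact: measurable_triangle.
    by apply/measurable_EFinP; apply: measurable_funTS; exact: measurable_ev2.
  transitivity (\int[mu2]_(y in triangle v) (ev2 p y)%:E)%E.
    by apply: eq_integral => y; rewrite inE => Ky /=; rewrite ger0_norm // p0.
  have fin : (\int[mu2]_(y in triangle v) (ev2 p y)%:E)%E \is a fin_num.
    by apply: integrable_fin_num; [exact: measurable_triangle | exact: integrable_ev2].
  by rewrite -(fineK fin); congr EFin; exact: Ip.
have near : \forall y \near x, (triangle v y /\ ev2 p y != 0).
  apply: (@filterI _ (nbhs x)).
    have : \forall y \near x, forall i, 0 < bary v i y.
      apply: (@filter_forall (R * R)%type _ (fun i y => is_true (0 < bary v i y)) (nbhs
        x)) => i.
      rewrite (_ : bary v i = ev2 (bary_poly i)) in hx *; last first.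
        by apply/funext => y; rewrite ev2_bary.
      apply: (cvgr_gt _ (@continuous_ev2 _ (bary_poly i) x)).
      by rewrite ev2_bary.
    by apply: (@filterS _ (nbhs x)) => y hy; rewrite triangleE => i; exact: ltW.
  have xp : 0 < ev2 p x by rewrite lt_def px p0.
  have : \forall y \near x, 0 < ev2 p y by apply: (cvgr_gt _ (@continuous_ev2 _ p x)).
  by apply: (@filterS _ (nbhs x)) => y; rewrite lt_def => /andP[].
have [[U V] /= [nU nV] UV] := near.
have [d1 /= d10 bU] := nU; have [d2 /= d20 bV] := nV.
pose B := ball x.1 d1 `*` ball x.2 d2.
have mB : measurable B by apply: measurableX; exact: measurable_ball.
have : mu2 B = 0%E.
  apply: measure_negligible => //; apply: negligibleS ae.
  move=> y [y1 y2] /=; have [Ky py] : triangle v y /\ ev2 p y != 0.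
    by apply: UV; split => /=; [exact: bU | exact: bV].
  by move=> /(_ Ky) /eqP; rewrite eqe (negPf py).
rewrite product_measure1E; [|exact: measurable_ball..].
rewrite /= !lebesgue_measure_ball ?ltW // -EFinM => /eqP; rewrite eqe.
by rewrite gt_eqF // mulr_gt0 // mulrn_wgt0.
Qed.

End TriangleIntegral.

(** * Substitution and total degree *)
Section Substitution.
Context {R : realType}.
Local Notation T := {poly {poly R}}.
Implicit Types (p q : T) (c : {poly R}) (n m : nat).

Variables (A B : T).

(** Substitution of B for the inner variable, then of A for the outer one. *)
Definition substY : {poly R} -> T :=
  @horner_morph R T (polyC \o polyC) B (fun=> mulrC _ _).
Definition subst2 : T -> T := @horner_morph {poly R} T substY A (fun=> mulrC _ _).

Lemma subst2_cons p c : subst2 (p * 'X + c%:P) = subst2 p * A + substY c.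
Proof. by rewrite /subst2 rmorphD rmorphM /= horner_morphX horner_morphC. Qed.

Lemma substY_cons c (a : R) : substY (c * 'X + a%:P) = substY c * B + a%:P%:P.
Proof. by rewrite /substY rmorphD rmorphM /= horner_morphX horner_morphC. Qed.

Lemma ev2_substY c x : ev2 (substY c) x = c.[ev2 B x].
Proof.
elim/poly_ind: c => [|c a IH]; first by rewrite /substY rmorph0 /ev2 !horner0.
by rewrite substY_cons hornerMXaddC -IH /ev2 !hornerE.
Qed.

Lemma ev2_subst2 p x : ev2 (subst2 p) x = ev2 p (ev2 A x, ev2 B x).
Proof.
elim/poly_ind: p => [|p c IH]; first by rewrite /subst2 rmorph0 /ev2 !horner0.
by rewrite subst2_cons ev2_cons -IH -ev2_substY /ev2 !hornerE.
Qed.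

(* D stands for either partial derivative; A and B are affine, whence the
   constants. *)
Variable (D : T -> T) (a b : R).
Hypotheses (DD : forall p q, D (p + q) = D p + D q)
  (DM : forall p q, D (p * q) = D p * q + p * D q)
  (DC : forall a : R, D a%:P%:P = 0)
  (DA : D A = a%:P%:P) (DB : D B = b%:P%:P).

Let D0 : D 0 = 0. Proof. by have := DC 0; rewrite !polyC0. Qed.

Lemma chain_substY c : D (substY c) = substY c^`() * b%:P%:P.
Proof.
elim/poly_ind: c => [|c e IH]; first by rewrite deriv0 /substY rmorph0 D0 mul0r.
rewrite substY_cons DD DM DC IH DB addr0 derivD derivM derivX derivC addr0.
by rewrite mulr1 /substY !(rmorphD, rmorphM) /= horner_morphX; ring.
Qed.

Lemma chain_subst2 p : D (subst2 p) = a%:P *: subst2 (pd1 p) + b%:P *: subst2 (pd2 p).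
Proof.
have e1 q : a%:P *: q = a%:P%:P * q by rewrite mul_polyC.
have e2 q : b%:P *: q = b%:P%:P * q by rewrite mul_polyC.
rewrite e1 e2; elim/poly_ind: p => [|p c IH].
  by rewrite /pd1 /pd2 deriv0 map_poly0 /subst2 rmorph0 D0; ring.
rewrite subst2_cons DD DM IH DA chain_substY pd2_cons subst2_cons /pd1.
rewrite derivD derivM derivX derivC addr0 mulr1 /subst2 !(rmorphD, rmorphM) /=.
by rewrite horner_morphX; ring.
Qed.

End Substitution.

Section TotalDegree.
Context {R : realType}.
Local Notation T := {poly {poly R}}.
Implicit Types (p q A B : T) (c : {poly R}) (n m : nat).

Definition tdeg_le n p : Prop := forall a b, (n < a + b)%N -> p`_a`_b = 0.

Lemma tdeg_le0 n : tdeg_le n 0.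
Proof. by move=> a b _; rewrite !coef0. Qed.

Lemma tdeg_leD n p q : tdeg_le n p -> tdeg_le n q -> tdeg_le n (p + q).
Proof. by move=> hp hq a b ab; rewrite !coefD hp // hq // addr0. Qed.

Lemma tdeg_leZ n p (e : R) : tdeg_le n p -> tdeg_le n (e%:P *: p).
Proof. by move=> hp a b ab; rewrite coefZ coefCM hp // mulr0. Qed.

Lemma tdeg_leM n m p q : tdeg_le n p -> tdeg_le m q -> tdeg_le (n + m) (p * q).
Proof.
move=> hp hq a b ab; rewrite coefM coef_sum big1 // => i _.
rewrite coefM big1 // => j _; have [h|h] := ltnP n (i + j); first by rewrite hp ?mul0r.
by rewrite hq ?mulr0 //; have := ltn_ord i; have := ltn_ord j; lia.
Qed.

Lemma tdeg_leS n m p : (n <= m)%N -> tdeg_le n p -> tdeg_le m p.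
Proof. by move=> nm hp a b ab; apply: hp; rewrite (leq_ltn_trans nm). Qed.

Lemma tdeg_leC n (e : R) : tdeg_le n e%:P%:P.
Proof. by case=> [|a] [|b] // _; rewrite !coefC //= coef0. Qed.

Lemma tdeg_le_sum n (I : Type) (r : seq I) (P : pred I) (F : I -> T) :
  (forall i, P i -> tdeg_le n (F i)) -> tdeg_le n (\sum_(i <- r | P i) F i).
Proof.
move=> h; elim/big_ind: _ => //; [exact: tdeg_le0 | exact: tdeg_leD].
Qed.

Lemma tdeg_leX n p k : tdeg_le n p -> tdeg_le (n * k) (p ^+ k).
Proof.
move=> hp; elim: k => [|k IH]; first by rewrite expr0 -polyC1 -polyC1; exact: tdeg_leC.
by rewrite exprS mulnS; apply: tdeg_leM.
Qed.

Lemma tdeg_le_subst2 n A B p : tdeg_le 1 A -> tdeg_le 1 B -> tdeg_le n p -> tdeg_le n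
  (subst2 A B p).
Proof.
move=> hA hB hp; rewrite /subst2 /horner_morph horner_coef.
apply: tdeg_le_sum => i _; rewrite coef_map_id0; last by rewrite /substY rmorph0.
rewrite /substY /horner_morph horner_coef mulr_suml.
apply: tdeg_le_sum => j _; rewrite coef_map /=.
have [h|h] := ltnP n (i + j); first by rewrite hp // !mul0r; exact: tdeg_le0.
apply: (tdeg_leS h); have -> : (i + j = 0 + 1 * j + 1 * i)%N by lia.
by apply: tdeg_leM; [apply: tdeg_leM; [exact: tdeg_leC | exact: tdeg_leX] | exact:
  tdeg_leX].
Qed.

Lemma size_tdeg n p : tdeg_le n p -> (size p <= n.+1)%N.
Proof.
move=> hp; apply/leq_sizeP => a na; apply/polyP => b; rewrite coef0 hp //.
by rewrite (leq_trans na) // leq_addr.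
Qed.

Lemma size_tdeg_coef n p a : (a <= n)%N -> tdeg_le n p -> (size (p`_a)%R <= (n - a).+1)%N.
Proof.
by move=> an hp; apply/leq_sizeP => b nb; rewrite hp //; lia.
Qed.

Lemma polyspaceP n (f : R * R -> R) :
  polyspace n%:Z f <-> exists2 p, tdeg_le n p & forall x, f x = ev2 p x.
Proof.
split=> [[c hc]|[p hp fp]].
  exists (\poly_(i < n.+1) \poly_(j < (n - i).+1) c i j).
    move=> a b ab; rewrite coef_poly; case: ltnP => an; last by rewrite coef0.
    by rewrite coef_poly; case: ltnP => //; lia.
  move=> x; rewrite hc /ev2 horner_poly horner_sum; apply: eq_bigr => i _.
  rewrite -polyC_exp hornerM hornerC horner_poly mulr_suml; apply: eq_bigr => j _.
  by rewrite mulrAC.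
exists (fun i j => p`_i`_j) => x; rewrite fp /ev2.
rewrite (horner_coef_wide _ (size_tdeg hp)) horner_sum; apply: eq_bigr => i _.
rewrite -polyC_exp hornerM hornerC.
have hi : (i <= n)%N by rewrite -ltnS.
rewrite (horner_coef_wide _ (size_tdeg_coef hi hp)) mulr_suml; apply: eq_bigr => j _.
by rewrite mulrAC.
Qed.

(** Beyond total degree n, the coefficients of q do not change from one power of the
    outer variable to the next, since the product with 'X - 1 has none there; and
    they are 0 for large powers. *)
Lemma tdeg_le_divX1 n q : tdeg_le n (q * ('X - 1)) -> forall a b, (n <= a + b)%N ->
  q`_a`_b = 0.
Proof.
move=> hq a b ab.
have step e : (n <= e + b)%N -> q`_e`_b = q`_e.+1`_b.
  move=> eb; have := hq e.+1 b; rewrite addSn ltnS => /(_ eb).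
  by rewrite mulrBr mulr1 coefB coefMX /= coefB => /eqP; rewrite subr_eq0 => /eqP.
have shift e : q`_a`_b = q`_(a + e)`_b.
  elim: e => [|e IH]; first by rewrite addn0.
  by rewrite IH addnS step //; lia.
by rewrite (shift (size q)) [q`__]nth_default ?coef0 // leq_addl.
Qed.

Lemma ev2_eq0 p : (forall s y, 0 < s < 1 -> - s < y < s -> ev2 p (s, y) = 0) -> p = 0.
Proof.
move=> hp.
have h1 s : 0 < s < 1 -> p.[s%:P] = 0.
  move=> hs; apply: (@poly_eq_itv _ _ _ (- s) s); first lra.
  by move=> y hy; rewrite horner0; exact: hp.
apply/polyP => a; apply/polyP => b; rewrite !coef0.
suff : \poly_(i < size p) p`_i`_b = 0.
  move=> /polyP /(_ a); rewrite coef_poly coef0; case: ltnP => // h _.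
  by rewrite [p`__]nth_default ?coef0.
apply: (@poly_eq_itv _ _ _ 0 1) => [//|s /h1 /polyP /(_ b)].
rewrite horner_poly horner0 coef0 horner_coef coef_sum => hb.
by rewrite -[RHS]hb; apply: eq_bigr => i _; rewrite -polyC_exp coefMC.
Qed.

End TotalDegree.

(** * Homogenization *)
Section Homogenization.
Context {R : realType}.
Local Notation T := {poly {poly R}}.
Implicit Types (g h : {poly R}) (N M : nat).

(** This is s^N g(y / s), with s the outer and y the inner variable; it is the form
    in which koornwinder uses the inner Jacobi polynomial. *)
Definition homog N g : T := \sum_(j < N.+1) (g`_j *: 'X^j)%:P * 'X^(N - j).

Lemma ev2_homog N g s y : ev2 (homog N g) (s, y) = \sum_(j < N.+1) g`_j * y ^+ j * s ^+
  (N - j).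
Proof.
rewrite /ev2 /homog !horner_sum; apply: eq_bigr => j _.
by rewrite !hornerE.
Qed.

Lemma ev2_homogE N g s y : (size g <= N.+1)%N -> s != 0 ->
  ev2 (homog N g) (s, y) = s ^+ N * g.[y / s].
Proof.
move=> sg s0; rewrite ev2_homog (horner_coef_wide _ sg) mulr_sumr.
apply: eq_bigr => j _; rewrite expr_div_n.
have -> : s ^+ N = s ^+ (N - j) * s ^+ j by rewrite -exprD subnK // -ltnS.
by field; rewrite expf_neq0.
Qed.

Lemma ev2_homog0 N g y : ev2 (homog N g) (0, y) = g`_N * y ^+ N.
Proof.
rewrite ev2_homog big_ord_recr /= subnn expr0 mulr1 big1 ?add0r // => j _.
by rewrite expr0n subn_eq0 leqNgt ltn_ord mulr0.
Qed.

Lemma ev2_homogM N M g h s y : (size g <= N.+1)%N -> (size h <= M.+1)%N ->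
  ev2 (homog (N + M) (g * h)) (s, y) = ev2 (homog N g) (s, y) * ev2 (homog M h) (s, y).
Proof.
(* At s = 0 only the coefficients of y^N, y^M and y^(N+M) remain. *)
move=> sg sh; have [->|s0] := eqVneq s 0.
  by rewrite !ev2_homog0 coef_topM // exprD; ring.
have sgh : (size (g * h)%R <= (N + M).+1)%N.
  by rewrite (leq_trans (size_polyMleq _ _)) //; move: (leq_add sg sh); lia.
by rewrite !ev2_homogE // hornerM exprD; ring.
Qed.

Lemma ev2_homog_diag N g (s e : R) : (size g <= N.+1)%N -> e ^+ 2 = 1 ->
  ev2 (homog N g) (s, e * s) = s ^+ N * g.[e].
Proof.
move=> sg e2; rewrite ev2_homog (horner_coef_wide _ sg) mulr_sumr.
apply: eq_bigr => j _; rewrite exprMn.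
have -> : s ^+ N = s ^+ (N - j) * s ^+ j by rewrite -exprD subnK // -ltnS.
by ring.
Qed.

Lemma pd2_homog N g : pd2 (homog N.+1 g) = homog N g^`().
Proof.
rewrite /homog (big_morph _ pd2D pd2_0) big_ord_recl /=.
rewrite pd2_monom derivZ expr0 -[1]/(1%:P) derivC scaler0 polyC0 mul0r add0r.
apply: eq_bigr => j _; rewrite pd2_monom derivZ derivXn coef_deriv.
by rewrite /bump /= add1n subSS add0n -scalerMnr scalerMnl.
Qed.

Lemma euler_homog N g s y :
  s * ev2 (pd1 (homog N g)) (s, y) + y * ev2 (pd2 (homog N g)) (s, y) =
  N%:R * ev2 (homog N g) (s, y).
Proof.
rewrite /homog /pd1 (big_morph _ pd2D pd2_0) (big_morph _ (@derivD _) (@deriv0 _)).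
rewrite /ev2 !horner_sum !mulr_sumr -big_split /=; apply: eq_bigr => j _.
rewrite pd2_monom derivM derivC mul0r add0r derivXn derivZ derivXn.
rewrite !hornerE /= !hornerMn !hornerE.
have -> : N%:R = (N - j)%:R + j%:R :> R by rewrite -natrD subnK // -ltnS.
have e (z : R) m : z * (z ^+ m.-1 *+ m) = m%:R * z ^+ m.
  by case: m => [|m]; rewrite ?mulr0n ?mulr0 ?mul0r // mulrnAr -exprS mulr_natl.
move: (e s (N - j)%N) (e y j); set u := s ^+ _ *+ _; set w := y ^+ _ *+ _ => eu ew.
transitivity ((s * u) * (g`_j * y ^+ j) + (y * w) * (g`_j * s ^+ (N - j))); first ring.
by rewrite eu ew; ring.
Qed.

End Homogenization.

(** * Coordinates adapted to an edge *)
Section BarycentricCoordinates.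
Context {R : realType}.
Variable (v : 'I_3 -> R * R).
Hypothesis hv : nondegenerate_triangle v.
Variable i : 'I_3.
Local Notation T := {poly {poly R}}.
Implicit Types (p q P Q : T).
Local Notation j := (nxt v i).
Local Notation k := (prv v i).

Lemma big_ord3 (S : Type) (idx : S) (op : Monoid.com_law idx) (F : 'I_3 -> S) :
  \big[op/idx]_l F l = op (op (F 0) (F 1)) (F (- 1)).
Proof.
rewrite !big_ord_recl big_ord0 Monoid.mulm1 Monoid.mulmA.
by congr (op (op (F _) (F _)) (F _)); apply: val_inj.
Qed.

Lemma sum_nxt_prv (V : nmodType) (F : 'I_3 -> V) : \sum_l F l = F i + F j + F k.
Proof.
rewrite sum_ord3 /nxt /prv; case: ifP => _; move: i; apply: ord3_cases;
  rewrite !ord3E; first [by [] | by rewrite -addrA addrC | by rewrite addrC addrA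
    | by rewrite addrAC | by rewrite [F 0 + F 1]addrC
    | by rewrite addrC [F 0 + F 1]addrC addrA].
Qed.

Lemma edge_bubbleE x : edge_bubble v i x = bary v j x * bary v k x.
Proof.
rewrite /edge_bubble big_mkcond (big_ord3 _ (fun l => if l != i then bary v l x else 1)).
rewrite /nxt /prv; case: (0 < orient v); move: i; apply: ord3_cases;
  by rewrite !ord3E /= ?(mul1r, mulr1) // mulrC.
Qed.

Lemma bubbleE x : bubble v x = bary v i x * edge_bubble v i x.
Proof. by rewrite /bubble (bigD1 i). Qed.

(** With s = sum_coord and y = diff_coord, the triangle is 0 <= s <= 1, |y| <= s, and
    the edge e_i is s = 1. *)
Definition sum_coord x : R := bary v j x + bary v k x.
Definition diff_coord x : R := bary v j x - bary v k x.

Lemma bary_coord x : bary v i x = 1 - sum_coord x.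
Proof. by rewrite -(bary_sum x hv) sum_nxt_prv /sum_coord; ring. Qed.

Lemma bary_nxt_coord x : bary v j x = (sum_coord x + diff_coord x) / 2.
Proof. by rewrite /sum_coord /diff_coord; field. Qed.

Lemma bary_prv_coord x : bary v k x = (sum_coord x - diff_coord x) / 2.
Proof. by rewrite /sum_coord /diff_coord; field. Qed.

Lemma nxt_prv_neq : ((j == i) = false) * ((k == i) = false) * ((k == j) = false).
Proof.
by rewrite /nxt /prv; case: (0 < orient v); move: i; apply: ord3_cases; rewrite !ord3E.
Qed.

Lemma coord_surj (s y : R) : exists x, sum_coord x = s /\ diff_coord x = y.
Proof.
pose c l := if l == i then 1 - s else if l == j then (s + y) / 2 else (s - y) / 2.
exists (\sum_l c l *: v l).
have c1 : \sum_l c l = 1.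
  by rewrite sum_nxt_prv /c !nxt_prv_neq !eqxx; field.
rewrite /sum_coord /diff_coord !bary_barycenter // /c !nxt_prv_neq !eqxx.
by split; field.
Qed.

(** The coordinates s and y as polynomials in x. *)
Definition sp : T := bary_poly v j + bary_poly v k.
Definition yp : T := bary_poly v j - bary_poly v k.

Lemma ev2_sp x : ev2 sp x = sum_coord x.
Proof. by rewrite /sp ev2D !ev2_bary. Qed.

Lemma ev2_yp x : ev2 yp x = diff_coord x.
Proof. by rewrite /diff_coord -!(ev2_bary hv) /yp /ev2 !hornerE. Qed.

Lemma ev2_coord P x : ev2 (subst2 sp yp P) x = ev2 P (sum_coord x, diff_coord x).
Proof. by rewrite ev2_subst2 ev2_sp ev2_yp. Qed.

Lemma tdeg_le_affine (a : R) (c : {poly R}) : (size c <= 2)%N -> tdeg_le 1 (a%:P%:P *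
  'X + c%:P).
Proof.
move=> sc [|[|e]] [|b] //= h; rewrite coefD coefMX !coefC /= ?coefD ?coefC ?coef0
  ?addr0 //.
by rewrite add0r nth_default // (leq_trans sc).
Qed.

Lemma tdeg_le_bary l : tdeg_le 1 (bary_poly v l).
Proof.
apply: tdeg_le_affine; rewrite (leq_trans (size_polyD _ _)) // geq_max.
rewrite (leq_trans (size_scale_leq _ _)) ?size_polyX //.
by rewrite (leq_trans (size_polyC_leq1 _)).
Qed.

Lemma tdeg_le_sp : tdeg_le 1 sp.
Proof. by apply: tdeg_leD; exact: tdeg_le_bary. Qed.

Lemma tdeg_le_yp : tdeg_le 1 yp.
Proof.
apply: tdeg_leD; first exact: tdeg_le_bary.
by move=> a b ab; rewrite !coefN (tdeg_le_bary _ ab) oppr0.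
Qed.

Lemma polyspace_coord n (f : R * R -> R) :
  polyspace n%:Z f <-> exists2 P, tdeg_le n P & forall x, f x = ev2 P (sum_coord x,
    diff_coord x).
Proof.
rewrite polyspaceP; split=> [[p hp fp]|[P hP fP]]; last first.
  exists (subst2 sp yp P); last by move=> x; rewrite ev2_coord.
  by apply: tdeg_le_subst2 => //; [exact: tdeg_le_sp | exact: tdeg_le_yp].
pose aff (c0 c1 c2 : R) : T := (- c0 + (c1 + c2) / 2)%:P%:P * 'X
  + (((c1 - c2) / 2) *: 'X + c0%:P)%:P.
have taff c0 c1 c2 : tdeg_le 1 (aff c0 c1 c2).
  apply: tdeg_le_affine; rewrite (leq_trans (size_polyD _ _)) // geq_max.
  rewrite (leq_trans (size_scale_leq _ _)) ?size_polyX //.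
  by rewrite (leq_trans (size_polyC_leq1 _)).
have eaff c0 c1 c2 s y : ev2 (aff c0 c1 c2) (s, y) =
    (1 - s) * c0 + (s + y) / 2 * c1 + (s - y) / 2 * c2.
  by rewrite /aff ev2_cons /ev2 !hornerE /=; field.
exists (subst2 (aff (v i).1 (v j).1 (v k).1) (aff (v i).2 (v j).2 (v k).2) p).
  exact: tdeg_le_subst2.
move=> x; rewrite fp ev2_subst2 !eaff; congr ev2.
rewrite -{1}(bary_comb x hv) sum_nxt_prv !scale_pairE -bary_coord -bary_nxt_coord
  -bary_prv_coord.
by congr pair.
Qed.

Lemma bary_det : bary_dx v j * bary_dy v k - bary_dx v k * bary_dy v j != 0.
Proof.
have := hv; rewrite /nondegenerate_triangle => o0.
have h : bary_dx v (i + 1) * bary_dy v (i - 1) - bary_dx v (i - 1) * bary_dy v (i + 1)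
    = (orient v)^-1.
  move: o0; rewrite /bary_dx /bary_dy /orient /signed_area2; move: i.
  by apply: ord3_cases; rewrite !ord3E => o0; field.
rewrite /nxt /prv; case: ifP => _; first by rewrite h invr_eq0.
by rewrite -opprB h oppr_eq0 invr_eq0.
Qed.

Definition coord_int P : R := tri_int v (subst2 sp yp P).

Lemma tri_int_ext p q : (forall x, ev2 p x = ev2 q x) -> tri_int v p = tri_int v q.
Proof. by move=> h; apply: eq_Rintegral => x _; rewrite h. Qed.

Lemma coord_int_ext P Q : (forall s y, ev2 P (s, y) = ev2 Q (s, y)) -> coord_int P =
  coord_int Q.
Proof. by move=> h; apply: tri_int_ext => x; rewrite !ev2_coord h. Qed.

Lemma coord_intD P Q : coord_int (P + Q) = coord_int P + coord_int Q.
Proof. by rewrite /coord_int -(tri_intD hv); congr tri_int; rewrite /subst2 rmorphD. Qed.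

Lemma coord_intZ (a : R) P : coord_int (a%:P *: P) = a * coord_int P.
Proof.
rewrite /coord_int -(tri_intZ hv); apply: tri_int_ext => x.
by rewrite ev2_coord /ev2 !hornerE -/(ev2 _ _) -/(ev2 _ _) ev2_coord.
Qed.

Lemma pd1_bary l : pd1 (bary_poly v l) = (bary_dx v l)%:P%:P.
Proof. by rewrite /pd1 /bary_poly derivD derivM !derivC derivX; ring. Qed.

Lemma pd2_bary l : pd2 (bary_poly v l) = (bary_dy v l)%:P%:P.
Proof.
rewrite /bary_poly pd2_cons derivD derivZ derivX derivC addr0 -polyC1 -mul_polyC.
by rewrite -polyCM mulr1 -[(bary_dx v l)%:P%:P]mulr1 -(expr0 'X) pd2_monom derivC
  polyC0 !mul0r add0r.
Qed.

(** The derivatives along the axes of the plane are combinations of those in s and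
    y with the invertible matrix of bary_det, and tri_int_pd1, tri_int_pd2 give two
    linear equations for the two integrals.  The condition on s and y says that
    the point is on one of the lines that carry the edges. *)
Lemma coord_int_pd P : (forall s y, (1 - s) * (s + y) * (s - y) = 0 -> ev2 P (s, y) =
  0) ->
  coord_int (pd1 P) = 0 /\ coord_int (pd2 P) = 0.
Proof.
move=> hP.
have hb x : bubble v x = 0 -> ev2 (subst2 sp yp P) x = 0.
  move=> hx; rewrite ev2_coord; apply: hP; move: hx.
  rewrite bubbleE edge_bubbleE bary_coord bary_nxt_coord bary_prv_coord => h.
  by rewrite -[RHS](mulr0 4) -h; field.
have pd2N p : pd2 (- p) = - pd2 p by rewrite /pd2 raddfN.
have C2 (a : R) : pd2 (a%:P%:P : T) = 0.
  by rewrite -[_%:P%:P]mulr1 -(expr0 'X) pd2_monom derivC polyC0 mul0r.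
have S1 : pd1 sp = (bary_dx v j + bary_dx v k)%:P%:P.
  by rewrite [LHS](derivD (bary_poly v j)) !polyCD; congr (_ + _); exact: pd1_bary.
have Y1 : pd1 yp = (bary_dx v j - bary_dx v k)%:P%:P.
  by rewrite [LHS](derivB (bary_poly v j)) !polyCB; congr (_ - _); exact: pd1_bary.
have S2 : pd2 sp = (bary_dy v j + bary_dy v k)%:P%:P by rewrite pd2D !pd2_bary !polyCD.
have Y2 : pd2 yp = (bary_dy v j - bary_dy v k)%:P%:P.
  by rewrite pd2D pd2N !pd2_bary !polyCB.
have h1 := tri_int_pd1 hv hb.
rewrite (chain_subst2 (D := @pd1 R) (@derivD _) (@derivM _) (fun a => derivC a%:P) S1
  Y1) in h1.
have h2 := tri_int_pd2 hv hb.
rewrite (chain_subst2 (@pd2D R) (@pd2M R) C2 S2 Y2) in h2.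
move: h1 h2; rewrite !tri_intD // !tri_intZ // -!/(coord_int _).
have := bary_det; move: (bary_dx v j) (bary_dx v k) (bary_dy v j) (bary_dy v k).
move: (coord_int (pd1 P)) (coord_int (pd2 P)) => X Y a b c d det h1 h2.
have e1 : (a * d - b * c) * X = 0.
  have -> : (a * d - b * c) * X =
    ((a - b) * ((c + d) * X + (c - d) * Y) - (c - d) * ((a + b) * X + (a - b) * Y)) / 2.
    by field.
  by rewrite h1 h2; field.
have e2 : (a * d - b * c) * Y = 0.
  have -> : (a * d - b * c) * Y =
    ((c + d) * ((a + b) * X + (a - b) * Y) - (a + b) * ((c + d) * X + (c - d) * Y)) / 2.
    by field.
  by rewrite h1 h2; field.
by split; apply/eqP; [move/eqP: e1 | move/eqP: e2]; rewrite mulf_eq0 (negPf det).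
Qed.

Lemma hornerMXn (c : {poly R}) n (x : R) : (c * 'X^n).[x] = c.[x] * x ^+ n.
Proof. by rewrite hornerM hornerXn. Qed.

Lemma ev2_mapC (phi : {poly R}) s y : ev2 (map_poly polyC phi) (s, y) = phi.[s].
Proof. by rewrite /ev2 /= horner_map hornerC. Qed.

Lemma pd2_mapC (phi : {poly R}) : pd2 (map_poly polyC phi) = 0.
Proof.
by apply/polyP => a; rewrite /pd2 coef_map_id0 ?deriv0 // coef_map derivC coef0.
Qed.

Lemma homog_edges N (g : {poly R}) s y : (size g <= N.+1)%N -> g.[1] = 0 -> g.[-1] = 0 ->
  (s + y) * (s - y) = 0 -> ev2 (homog N g) (s, y) = 0.
Proof.
move=> sg g1 g2 /eqP; rewrite mulf_eq0 => /orP[/eqP h|/eqP h].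
- have -> : y = -1 * s by lra.
  by rewrite ev2_homog_diag ?sqrrN ?expr1n // g2 mulr0.
- have -> : y = 1 * s by lra.
  by rewrite ev2_homog_diag ?expr1n // g1 mulr0.
Qed.

(** The integrand is the derivative in y of s^(N+1) G(y / s) phi(s), which vanishes
    on all three edges. *)
Lemma coord_int_homog_deriv N (G phi : {poly R}) : (size G <= N.+2)%N ->
  G.[1] = 0 -> G.[-1] = 0 -> phi.[1] = 0 ->
  coord_int (homog N G^`() * map_poly polyC phi) = 0.
Proof.
move=> sG G1 G2 p1.
have van s y : (1 - s) * (s + y) * (s - y) = 0 ->
    ev2 (homog N.+1 G * map_poly polyC phi) (s, y) = 0.
  rewrite ev2M ev2_mapC -mulrA => /eqP.
  rewrite mulf_eq0 => /orP[/eqP h|/eqP h].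
  - by have -> : s = 1 by [lra]; rewrite p1 mulr0.
  - by rewrite homog_edges // mul0r.
by have [_] := coord_int_pd van; rewrite pd2M pd2_mapC mulr0 addr0 pd2_homog.
Qed.

(** Let s^(N+2) phi be the antiderivative of s^(N+1) psi that vanishes at 0; it also
    vanishes at 1.  Then psi = (N + 2) phi + s phi', and by Euler's identity
    h psi, with h = s^N g(y / s), is the divergence of the field (s, y) h phi, which
    vanishes on all three edges. *)
Lemma coord_int_homog_polyint N (g psi : {poly R}) : (size g <= N.+1)%N ->
  g.[1] = 0 -> g.[-1] = 0 -> polyint 0 1 ('X^(N.+1) * psi) = 0 ->
  coord_int (homog N g * map_poly polyC psi) = 0.
Proof.
move=> sg g1 g2 Ip.
pose phi := drop_poly N.+2 (antideriv ('X^(N.+1) * psi)).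
have Pphi : antideriv ('X^(N.+1) * psi) = phi * 'X^(N.+2).
  rewrite -[LHS](poly_take_drop N.+2) [X in X + _](_ : _ = 0) ?add0r //.
  apply/polyP => l; rewrite coef_take_poly coef0 coef_antideriv coefXnM.
  by case: ltnP => // hl; case: l hl => [|l] hl; rewrite ?invr0 ?mulr0 //= ltnS in hl *;
    rewrite hl mul0r.
have phi1 : phi.[1] = 0.
  move: Ip; rewrite /polyint Pphi !hornerMXn.
  by rewrite expr1n mulr1 expr0n mulr0 subr0.
clearbody phi.
have psiE : N.+2%:R *: phi + 'X * phi^`() = psi.
  have X0 : ('X^(N.+1) : {poly R}) != 0 by rewrite expf_neq0 // polyX_eq0.
  apply: (mulfI X0); rewrite -[RHS]deriv_antideriv Pphi derivM derivXn /= exprS.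
  by rewrite -mul_polyC polyC_natr [in RHS]exprS -[in RHS](mulr_natr (_ * _)) exprS; ring.
pose F := homog N g * map_poly polyC phi.
have vanish P s y : (1 - s) * (s + y) * (s - y) = 0 -> ev2 (P * F) (s, y) = 0.
  rewrite !ev2M ev2_mapC -mulrA => /eqP.
  rewrite mulf_eq0 => /orP[/eqP h|/eqP h].
  - by have -> : s = 1 by [lra]; rewrite phi1 !mulr0.
  - by rewrite homog_edges // mul0r mulr0.
have [h1 _] := coord_int_pd (vanish 'X).
have [_ h2] := coord_int_pd (vanish 'X%:P).
rewrite -[RHS]addr0 -{2}h2 -h1 -coord_intD; apply: coord_int_ext => s y.
have := euler_homog N g s y.
rewrite /pd1 !derivM derivX -/(pd1 _) deriv_map pd2M /F pd2M pd2_mapC mulr0 addr0.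
rewrite -[('X%:P : T)]mulr1 -(expr0 'X) pd2_monom derivX polyC1 mul1r expr0 mulr1.
rewrite !(ev2D, ev2M) !ev2_mapC -psiE -polyC1.
rewrite (_ : ev2 'X (s, y) = s); last by rewrite /ev2 !hornerE.
rewrite (_ : ev2 'X%:P (s, y) = y); last by rewrite /ev2 !hornerE.
rewrite (_ : ev2 1%:P (s, y) = 1); last by rewrite /ev2 !hornerE.
rewrite hornerD hornerZ hornerM hornerX -!natr1 => e.
transitivity (ev2 (homog N g) (s, y) * (2 * phi.[s] + s * phi^`().[s]) +
  (N%:R * ev2 (homog N g) (s, y)) * phi.[s]); first ring.
by rewrite -e; ring.
Qed.

End BarycentricCoordinates.

(** * Koornwinder polynomials *)
Section JacobiBasis.
Context {R : realType}.

Lemma poly_basis (P : nat -> {poly R}) (m : nat) (g : {poly R}) :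
  (forall k, (size (P k) <= k.+1)%N) -> (forall k, (P k)`_k != 0) ->
  (size g <= m)%N -> exists c : nat -> R, g = \sum_(k < m) c k *: P k.
Proof.
move=> sP P0; elim: m g => [|m IH] g sg.
  by exists (fun=> 0); rewrite big_ord0; apply/eqP; rewrite -size_poly_leq0.
have [|c hc] := IH (g - (g`_m / (P m)`_m) *: P m).
  apply/leq_sizeP => l; rewrite leq_eqVlt => /predU1P[<-|ml].
    by rewrite coefB coefZ divfK // subrr.
  rewrite coefB coefZ; have -> : g`_l = 0 by apply: nth_default; exact: leq_trans sg ml.
  have -> : (P m)`_l = 0 by apply: nth_default; exact: leq_trans (sP m) ml.
  by rewrite mulr0 subrr.
exists (fun k => if k == m then g`_m / (P m)`_m else c k).
rewrite big_ord_recr /= eqxx -[LHS](subrK ((g`_m / (P m)`_m) *: P m)) hc.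
congr (_ + _); apply: eq_bigr => k _.
by rewrite ltn_eqF.
Qed.

Lemma polyint_flip (p : {poly R}) :
  polyint 0 1 (p \Po (1 - 2%:P * 'X)) = polyint (-1) 1 p / 2.
Proof.
have -> : p \Po (1 - 2%:P * 'X) = (- 2^-1) *: (antideriv p \Po (1 - 2%:P * 'X))^`().
  rewrite deriv_comp deriv_antideriv.
  have -> : (1 - 2%:P * 'X)^`() = (- 2)%:P :> {poly R}.
    by rewrite derivB derivM derivX -polyC1 !derivC polyC1 polyCN; ring.
  by rewrite [_ * (- 2)%:P]mulrC (mul_polyC (- 2)) scalerA mulrNN mulVf ?scale1r //
    pnatr_eq0.
rewrite linearZ /= polyint_deriv !horner_comp !hornerE /polyint.
have -> : 1 - 2 = -1 :> R by ring.
by rewrite subr0; field.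
Qed.

End JacobiBasis.

Section KoornwinderSpace.
Context {R : realType}.
Variable (v : 'I_3 -> R * R).
Hypothesis hv : nondegenerate_triangle v.
Variable i : 'I_3.
Local Notation T := {poly {poly R}}.
Implicit Types (P Q : T) (m k a b : nat).
Local Notation cs := (sum_coord v i).
Local Notation cy := (diff_coord v i).
Local Notation ci := (coord_int v i).

(** The factor of Koornwinder's polynomial that depends on s only: its argument
    lambda_i - lambda_i^+ - lambda_i^- equals 1 - 2 s. *)
Definition radial m k : {poly R} :=
  jacobi (2 * k + 5)%:R 1%:R (m - k) \Po (1 - 2%:P * 'X).

Definition koorn_poly m k : T := homog k (jacobi 2 2 k) * map_poly polyC (radial m k).

Lemma horner_radial m k s :
  (radial m k).[s] = (jacobi (2 * k + 5)%:R 1%:R (m - k)).[1 - 2 * s].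
Proof. by rewrite /radial horner_comp !hornerE. Qed.

Lemma horner_radial1 m k : (radial m k).[1] = (-1) ^+ (m - k) * (m - k).+1%:R.
Proof.
by rewrite horner_radial mulr1 (_ : 1 - 2 = -1) ?horner_jacobi1_m1 //; ring.
Qed.

Lemma ev2_koorn_poly m k s y : ev2 (koorn_poly m k) (s, y) =
  ev2 (homog k (jacobi 2 2 k)) (s, y) * (radial m k).[s].
Proof. by rewrite /koorn_poly ev2M ev2_mapC. Qed.

Lemma koornwinder_koorn_poly m k x :
  koornwinder 1 2 2 k m (bary v i x) (bary v (nxt v i) x) (bary v (prv v i) x) =
  ev2 (koorn_poly m k) (cs x, cy x).
Proof.
rewrite /koornwinder ev2_koorn_poly ev2_homog horner_radial; congr (_ * _).
have -> : (2 * k)%:R + 2 + 2 + 1 = (2 * k + 5)%:R :> R by rewrite natrD; ring.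
by congr (_.[_]); rewrite (bary_coord hv) /sum_coord; ring.
Qed.

Lemma tdeg_le_homog N (g : {poly R}) : tdeg_le N (homog N g).
Proof.
apply: tdeg_le_sum => l _ a b ab; rewrite coefCM coefXn.
have [al|al] := eqVneq a (N - l)%N; last by rewrite mulr0 coef0.
rewrite mulr1 coefZ coefXn; case: eqP => [bl|]; last by rewrite mulr0.
by have := ltn_ord l; lia.
Qed.

Lemma tdeg_le_mapC n (phi : {poly R}) : (size phi <= n.+1)%N -> tdeg_le n (map_poly
  polyC phi).
Proof.
move=> sp a [|b] ab; rewrite coef_map coefC //=.
by rewrite nth_default // (leq_trans sp) // -[a]addn0.
Qed.

Lemma tdeg_le_koorn_poly m k : (k <= m)%N -> tdeg_le m (koorn_poly m k).
Proof.
move=> km; rewrite -(subnKC km); apply: tdeg_leM; first exact: tdeg_le_homog.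
rewrite subnKC //; apply: tdeg_le_mapC.
rewrite (leq_trans (size_comp_poly_leq _ _)) // ltnS.
have s2 : (size (1 - 2%:P * 'X : {poly R})%R <= 2)%N.
  rewrite (leq_trans (size_polyD _ _)) // size_polyN size_poly1 geq_max /=.
  by rewrite mul_polyC (leq_trans (size_scale_leq _ _)) // size_polyX.
have s1 := @size_jacobi R (2 * k + 5)%:R 1%:R (m - k).
rewrite -[X in (_ <= X)%N]muln1 leq_mul //.
  by move: s1; case: (size _).
by move: s2; case: (size _).
Qed.

(** 16 b_K b_i in the coordinates s and y, see weightE. *)
Definition weight_poly : T := (1 - 'X) * ('X^2 - ('X^2)%:P) ^+ 2.

Lemma ev2_weight_poly (s y : R) : ev2 weight_poly (s, y) = (1 - s) * (s ^+ 2 - y ^+ 2)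
  ^+ 2.
Proof. by rewrite /ev2 /weight_poly !hornerE. Qed.

Lemma weightE x : bubble v x * edge_bubble v i x = ev2 weight_poly (cs x, cy x) / 16.
Proof.
rewrite (bubbleE v i) edge_bubbleE (bary_coord hv) bary_nxt_coord bary_prv_coord
  ev2_weight_poly.
by field.
Qed.

Lemma ev2_homog_weight (s y : R) : ev2 (homog 4 (jacobi_weight 2 2)) (s, y) = (s ^+ 2 -
  y ^+ 2) ^+ 2 :> R.
Proof.
have h1 : ev2 (homog 1 (1 - 'X)) (s, y) = s - y.
  by rewrite ev2_homog big_ord_recl big_ord1 !coefB !coef1 !coefX /=; ring.
have h2 : ev2 (homog 1 (1 + 'X)) (s, y) = s + y.
  by rewrite ev2_homog big_ord_recl big_ord1 !coefD !coef1 !coefX /=; ring.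
rewrite /jacobi_weight !expr2 (_ : 4 = (1 + 1) + (1 + 1))%N // !ev2_homogM
  ?size_polyM_leS ?size_1subX ?size_1addX // h1 h2.
by ring.
Qed.

(** For b < k the integral in y / s vanishes, by orthogonality of P_k^(2,2) to
    lower powers.  For b >= k the integral in s vanishes: s^(N+1) = s^(5+k+b) times
    s^a is s^(2k+5) times s^(a+b-k), and a + b - k < m - k. *)
Lemma coord_int_weight_monom m k a b : (k <= m)%N -> (a + b < m)%N ->
  ci (weight_poly * koorn_poly m k * ('X^a * ('X^b)%:P)) = 0.
Proof.
move=> km abm.
pose g : {poly R} := jacobi_weight 2 2 * jacobi 2 2 k * 'X^b.
pose psi : {poly R} := (1 - 'X) * radial m k * 'X^a.
have sw : (size (jacobi_weight 2 2 : {poly R}) <= 5)%N by apply: size_jacobi_weight.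
have sJ : (size (jacobi 2 2 k : {poly R}) <= k.+1)%N by apply: size_jacobi.
have sb : (size ('X^b : {poly R})%R <= b.+1)%N by rewrite size_polyXn.
have sg : (size g <= (4 + k + b).+1)%N by rewrite !size_polyM_leS.
have -> : ci (weight_poly * koorn_poly m k * ('X^a * ('X^b)%:P)) =
    ci (homog (4 + k + b) g * map_poly polyC psi).
  apply: (coord_int_ext hv) => s y; have -> : ev2 (weight_poly * koorn_poly m k * ('X^a
    * ('X^b)%:P)) (s, y) =
      ev2 weight_poly (s, y) * ev2 (koorn_poly m k) (s, y) * (s ^+ a * y ^+ b).
    by rewrite /ev2 !hornerE.
  rewrite ev2_weight_poly ev2_koorn_poly ev2M ev2_mapC.
  rewrite !ev2_homogM ?size_polyM_leS // ev2_homog_weight /psi !hornerM hornerXn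
    hornerD hornerN hornerX hornerC.
  have -> : ev2 (homog b 'X^b) (s, y) = y ^+ b.
    rewrite ev2_homog big_ord_recr /= subnn expr0 mulr1 coefXn eqxx mul1r.
    by rewrite big1 ?add0r // => l _; rewrite coefXn ltn_eqF ?mul0r.
  by ring.
have psi1 : psi.[1] = 0 by rewrite /psi !hornerM hornerD hornerN hornerX hornerC subrr
  !mul0r.
have g1 : g.[1] = 0 by rewrite /g -mulrA hornerM jacobi_weightE subrr expr0n !mul0r.
have g2 : g.[-1] = 0 by rewrite /g -mulrA hornerM jacobi_weightE subrr expr0n !(mulr0,
  mul0r).
have [bk|kb] := ltnP b k.
  pose G := antideriv g - ((antideriv g).[1])%:P.
  have gG : g = G^`() by rewrite /G derivB derivC subr0 deriv_antideriv.
  have Ig : polyint (-1) 1 g = 0.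
    by apply: (jacobi_orthogonal 2 2); rewrite size_polyXn.
  rewrite gG; apply: coord_int_homog_deriv => //.
  - apply/leq_sizeP => l hl; rewrite /G coefB coefC coef_antideriv.
    case: l hl => // l hl; rewrite subr0 /= nth_default ?mul0r //.
    by rewrite (leq_trans sg).
  - by rewrite /G hornerD hornerN hornerC subrr.
  - rewrite /G hornerD hornerN hornerC; move/eqP: Ig.
    by rewrite /polyint subr_eq0 => /eqP->; rewrite subrr.
apply: coord_int_homog_polyint => //.
pose c := (a + b - k)%N.
have -> : 'X^((4 + k + b).+1) * psi = (2 ^+ (2 * k + 6 + c))^-1 *:
    ((jacobi_weight (2 * k + 5) 1 * jacobi (2 * k + 5)%:R 1%:R (m - k) * (1 - 'X) ^+ c)
      \Po (1 - 2%:P * 'X)).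
  have compX (p : {poly R}) l : p ^+ l \Po (1 - 2%:P * 'X) = (p \Po (1 - 2%:P * 'X)) ^+ l.
    exact: (rmorphXn (comp_poly (1 - 2%:P * 'X))).
  rewrite !(comp_polyM _ (_ ^+ _)) comp_polyM -/(radial m k) /jacobi_weight.
  rewrite comp_polyM !compX comp_polyB comp_polyD comp_polyX.
  rewrite -[in 1 \Po _]polyC1 comp_polyC polyC1.
  have -> : 1 - (1 - 2%:P * 'X) = 2%:P * 'X :> {poly R} by ring.
  have -> : 1 + (1 - 2%:P * 'X) = 2%:P * (1 - 'X) :> {poly R}.
    by rewrite (_ : 2%:P = 1 + 1) ?polyCD ?polyC1 //; ring.
  rewrite expr1 !exprMn -!polyC_exp -mul_polyC.
  have -> : (2 * k + 6 + c = (2 * k + 5) + 1 + c)%N by lia.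
  have -> : ((4 + k + b).+1 = (2 * k + 5) + (b - k))%N by lia.
  have -> : (2 ^+ (2 * k + 5))%:P * 'X^(2 * k + 5) * (2%:P * (1 - 'X)) *
      radial m k * ((2 ^+ c)%:P * 'X^c) =
      (2 ^+ (2 * k + 5 + 1 + c))%:P * ('X^(2 * k + 5) * 'X^c * ((1 - 'X) * radial m k)).
    by rewrite !exprD expr1 !polyCM; ring.
  rewrite [RHS]mulrA -polyCM mulVf ?expf_neq0 ?pnatr_eq0 // mul1r.
  have -> : (c = b - k + a)%N by rewrite /c; lia.
  by rewrite /psi !exprD; ring.
rewrite linearZ /= polyint_flip.
rewrite jacobi_orthogonal ?mul0r ?mulr0 //.
by rewrite (leq_trans (size_exp_le2 _ size_1subX)) // /c; lia.
Qed.

Lemma coord_int0 : ci 0 = 0.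
Proof. by have := coord_intZ hv i 0 0; rewrite scaler0 mul0r. Qed.

Lemma coord_int_sum0 n (F : 'I_n -> T) : (forall l, ci (F l) = 0) -> ci (\sum_l F l) = 0.
Proof.
move=> F0; apply: (big_ind (fun p => ci p = 0)).
- exact: coord_int0.
- by move=> p q p0 q0; rewrite (coord_intD hv i) p0 q0 addr0.
- by move=> l _; exact: F0.
Qed.

Lemma coord_int_weight m k Q : (k <= m)%N -> (forall a b, (m <= a + b)%N -> Q`_a`_b =
  0) ->
  ci (weight_poly * koorn_poly m k * Q) = 0.
Proof.
move=> km hQ; pose M := (\max_(a < size Q) size (Q`_a)%R)%N.
have sQ a : (a < size Q -> size (Q`_a)%R <= M)%N.
  by move=> h; exact: (leq_bigmax (Ordinal h)).
have -> : Q = \sum_(a < size Q) \sum_(b < M) (Q`_a`_b)%:P *: ('X^a * ('X^b)%:P).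
  rewrite -[LHS]coefK poly_def; apply: eq_bigr => a _.
  have e : Q`_a = \sum_(b < M) Q`_a`_b *: 'X^b.
    apply/polyP => l; rewrite -(@poly_def _ M (fun b => Q`_a`_b)) coef_poly.
    case: ltnP => // hl; rewrite [LHS]nth_default // (leq_trans _ hl) //; exact: sQ.
  rewrite [X in X *: _ = _]e scaler_suml; apply: eq_bigr => b _.
  by rewrite -!mul_polyC polyCM; ring.
rewrite mulr_sumr; apply: coord_int_sum0 => a; rewrite mulr_sumr; apply: coord_int_sum0
  => b.
rewrite -scalerAr coord_intZ //.
have [h|h] := leqP m (a + b); first by rewrite hQ // mul0r.
by rewrite coord_int_weight_monom // mulr0.
Qed.

Lemma polyspace_pred m (q : R * R -> R) : polyspace (m%:Z - 1) q <->
  exists2 Q : T, (forall a b, (m <= a + b)%N -> Q`_a`_b = 0) &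
    forall x, q x = ev2 Q (cs x, cy x).
Proof.
case: m => [|m].
  have -> : 0%:Z - 1 = Negz 0 by [].
  split=> [h|[Q hQ qQ]] /=.
    by exists 0 => [a b _|x]; [rewrite !coef0 | rewrite h /ev2 !horner0].
  have Q0 : Q = 0 by apply/polyP => a; apply/polyP => b; rewrite hQ // !coef0.
  by move=> x; rewrite qQ Q0 /ev2 !horner0.
have -> : m.+1%:Z - 1 = m%:Z by rewrite -addn1 PoszD addrK.
rewrite (polyspace_coord hv i); split=> -[Q hQ qQ]; exists Q => // a b ab; exact: hQ.
Qed.

Lemma integral_weight (F Q : T) :
  \int[(lebesgue_measure \x lebesgue_measure)%E]_(x in triangle v)
    (bubble v x * edge_bubble v i x * ev2 F (cs x, cy x) * ev2 Q (cs x, cy x)) =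
  ci (weight_poly * F * Q) / 16.
Proof.
rewrite mulrC -coord_intZ //; apply: eq_Rintegral => x _.
by rewrite ev2_coord // weightE ev2Z (ev2M (weight_poly * F)) (ev2M weight_poly); ring.
Qed.

Lemma koornwinder_Qspace m k (c : R) : (k <= m)%N ->
  Qspace v i m%:Z (fun x => c * koornwinder 1 2 2 k m
    (bary v i x) (bary v (nxt v i) x) (bary v (prv v i) x)).
Proof.
move=> km; have e x : c * koornwinder 1 2 2 k m (bary v i x) (bary v (nxt v i) x)
    (bary v (prv v i) x) = ev2 (c%:P *: koorn_poly m k) (cs x, cy x).
  by rewrite koornwinder_koorn_poly /ev2 !hornerE.
split.
  apply/(polyspace_coord hv i); exists (c%:P *: koorn_poly m k) => //.
  by apply: tdeg_leZ; exact: tdeg_le_koorn_poly.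
move=> q /polyspace_pred[Q hQ qQ].
under eq_Rintegral do rewrite e qQ.
by rewrite integral_weight -scalerAr -scalerAl coord_intZ // coord_int_weight // mulr0
  mul0r.
Qed.

(** The integrand is minus the square of U, a multiple of b_K times Q. *)
Lemma weight_poly_definite Q : ci (weight_poly * (Q * ('X - 1)) * Q) = 0 -> Q = 0.
Proof.
pose U := (1 - 'X) * ('X^2 - ('X^2)%:P) * Q.
have eU s y : ev2 U (s, y) = (1 - s) * (s ^+ 2 - y ^+ 2) * ev2 Q (s, y).
  by rewrite /U ev2M; congr (_ * _); rewrite /ev2 !hornerE.
have -> : ci (weight_poly * (Q * ('X - 1)) * Q) = - ci (U * U).
  rewrite -[RHS]mulN1r -(coord_intZ hv i (-1) (U * U)); apply: (coord_int_ext hv) => s y.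
  rewrite ev2Z (ev2M (weight_poly * _)) (ev2M weight_poly) (ev2M Q) (ev2M U)
    ev2_weight_poly eU.
  by rewrite (_ : ev2 ('X - 1) (s, y) = s - 1); [ring | rewrite /ev2 !hornerE].
move/eqP; rewrite oppr_eq0 => /eqP h.
apply: ev2_eq0 => s y hs hy.
have [x [xs xy]] := coord_surj hv i s y.
have pos l : 0 < bary v l x.
  have hi : 0 < bary v i x by rewrite (bary_coord hv) xs; lra.
  have hj : 0 < bary v (nxt v i) x by rewrite bary_nxt_coord xs xy; lra.
  have hk : 0 < bary v (prv v i) x by rewrite bary_prv_coord xs xy; lra.
  move: hi hj hk; rewrite /nxt /prv; case: (0 < orient v); move: (i) l;
    by apply: ord3_cases; apply: ord3_cases; rewrite !ord3E.
have := tri_int_eq0 hv _ h pos; rewrite ev2_coord // xs xy.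
have -> : ev2 (U * U) (s, y) = ((1 - s) * (s ^+ 2 - y ^+ 2) * ev2 Q (s, y)) ^+ 2.
  by rewrite (ev2M U) eU; ring.
move=> /(_ _)/eqP; rewrite expf_eq0 /= !mulf_eq0 => hU.
have : [|| 1 - s == 0, s ^+ 2 - y ^+ 2 == 0 | ev2 Q (s, y) == 0].
  rewrite orbA; apply: hU => z _; rewrite ev2_coord // ev2M.
  by rewrite -expr2 sqr_ge0.
case/or3P => /eqP //; first lra.
by have : 0 < s ^+ 2 - y ^+ 2 by [nra]; lra.
Qed.

(** G, the difference of q and the combination that agrees with it on s = 1, is
    divisible by s - 1; the quotient Q has degree less than m, so q and the
    Koornwinder polynomials are orthogonal to it, and weight_poly_definite applies. *)
Lemma Qspace_span m (f : R * R -> R) : Qspace v i m%:Z f ->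
  exists c : nat -> R, forall x, f x = \sum_(k < m.+1) c k *
    koornwinder 1 2 2 k m (bary v i x) (bary v (nxt v i) x) (bary v (prv v i) x).
Proof.
move=> [/(polyspace_coord hv i)[F tF fF] orth].
have r0 k : (radial m k).[1] != 0.
  by rewrite horner_radial1 mulf_neq0 ?pnatr_eq0 // expf_neq0 // oppr_eq0 oner_eq0.
have sF1 : (size (F.[1])%R <= m.+1)%N.
  apply/leq_sizeP => b hb; rewrite horner_coef coef_sum big1 // => a _.
  by rewrite expr1n mulr1 tF // (leq_trans hb) // leq_addl.
have [c hc] := poly_basis (@size_jacobi R 2 2) (fun k => coef_jacobi_neq0 2 2 k) sF1.
pose d k := c k / (radial m k).[1].
pose G := F - \sum_(k < m.+1) (d k)%:P *: koorn_poly m k.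
have eG x : ev2 G x = ev2 F x - \sum_(k < m.+1) d k * ev2 (koorn_poly m k) x.
  rewrite /G /ev2 !hornerE !horner_sum; congr (_ - _).
  by apply: eq_bigr => k _; rewrite !hornerE.
have G1 : G.[1] = 0.
  apply: (@poly_eq_itv _ _ _ 0 1) => // y _; rewrite horner0 -polyC1.
  rewrite -/(ev2 G (1, y)) eG {1}/ev2 polyC1 hc horner_sum.
  apply/eqP; rewrite subr_eq0; apply/eqP; apply: eq_bigr => k _.
  rewrite ev2_koorn_poly ev2_homogE ?size_jacobi ?oner_eq0 // expr1n mul1r divr1
    hornerZ /d.
  by field.
have [Q GQ] : exists Q, G = Q * ('X - 1%:P) by apply/factor_theorem/eqP.
have tG : tdeg_le m G.
  apply: tdeg_leD => // a b ab; rewrite !coefN.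
  rewrite (@tdeg_le_sum _ m _ _ _ _ _ a b ab) ?oppr0 // => k _.
  by apply: tdeg_leZ; apply: tdeg_le_koorn_poly; rewrite -ltnS.
have hQ : forall a b, (m <= a + b)%N -> Q`_a`_b = 0.
  by apply: tdeg_le_divX1; rewrite -polyC1 -GQ.
have oF : ci (weight_poly * F * Q) = 0.
  have := orth (fun x => ev2 Q (cs x, cy x)).
  under eq_Rintegral do rewrite fF.
  rewrite integral_weight => h; apply/eqP; rewrite -(mulIr_eq0 _ (@mulIf _ 16^-1 _))
    ?invr_eq0 ?pnatr_eq0 //.
  by apply/eqP/h/polyspace_pred; exists Q.
have Q0 : Q = 0.
  apply: weight_poly_definite; rewrite -polyC1 -GQ /G.
  have -> : weight_poly * (F - \sum_(k < m.+1) (d k)%:P *: koorn_poly m k) * Q =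
      weight_poly * F * Q + \sum_(k < m.+1) (- d k)%:P *: (weight_poly * koorn_poly m k
        * Q).
    rewrite mulrBr mulrBl; congr (_ + _); rewrite mulr_sumr mulr_suml -sumrN.
    by apply: eq_bigr => k _; rewrite -!mul_polyC polyCN; ring.
  have term (k : 'I_m.+1) : ci ((- d k)%:P *: (weight_poly * koorn_poly m k * Q)) = 0.
    by rewrite (coord_intZ hv i (- d k)) (@coord_int_weight m k Q _ hQ) ?mulr0 // -ltnS.
  have -> : ci (weight_poly * F * Q + \sum_(k < m.+1) (- d k)%:P *: (weight_poly *
    koorn_poly m k * Q)) =
      ci (weight_poly * F * Q) + ci (\sum_(k < m.+1) (- d k)%:P *: (weight_poly *
        koorn_poly m k * Q)).
    exact: (coord_intD hv i).
  by rewrite oF add0r; exact: coord_int_sum0.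
exists d => x; have := eG (cs x, cy x).
rewrite GQ Q0 mul0r {1}/ev2 !horner0 fF => /esym/eqP; rewrite subr_eq0 => /eqP->.
by apply: eq_bigr => k _; rewrite koornwinder_koorn_poly.
Qed.

End KoornwinderSpace.

(** * Normal derivatives on an edge *)
Section DirectionalDerivative.
Context {R : realType}.
Local Notation T := {poly {poly R}}.

(** Reduces directional derivatives to derivatives in one real variable, where the
    rules for polynomials are available. *)
Lemma is_derive_line (f : R * R -> R) (x d : R * R) (l : R) :
  is_derive (0 : R) (1 : R) (fun h => f (h *: d + x)) l -> is_derive x d f l.
Proof.
move=> [fd fl].
have e : (fun h => h^-1 *: (((fun h => f (h *: d + x)) \o shift 0) (h *: 1) -
    (fun h => f (h *: d + x)) 0)) = (fun h => h^-1 *: ((f \o shift x) (h *: d) - f x)).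
  apply/funext => h /=; congr (_ *: (f _ - f _)); last by rewrite scale0r add0r.
  by rewrite addr0 [_ *: 1]mulr1.
by split; [rewrite /derivable -e | rewrite /derive -e].
Qed.

Lemma derive_ev2 (p : T) (x d : R * R) :
  is_derive x d (ev2 p) (ev2 (d.1%:P *: pd1 p + d.2%:P *: pd2 p) x).
Proof.
apply: is_derive_line; elim/poly_ind: p => [|p c IH].
  rewrite (_ : (fun h => _) = cst 0); last by apply/funext => h; rewrite /ev2 !horner0.
  apply: is_derive_eq.
  by rewrite /pd1 /pd2 deriv0 map_poly0 !scaler0 addr0 /ev2 !horner0.
pose a1 := d.1 *: 'X + (x.1)%:P; pose a2 := d.2 *: 'X + (x.2)%:P.
rewrite (_ : (fun h => _) = (fun h : R => ev2 p (h *: d + x)) * (horner a1)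
   + horner (c \Po a2)); last first.
  apply/funext => h; rewrite ev2_cons /a1 /a2 !fctE /= horner_comp !hornerE.
  by rewrite [d.1 * h]mulrC [d.2 * h]mulrC.
have D1 := is_deriveD (is_deriveM IH (is_derive_poly a1 0)) (is_derive_poly (c \Po a2) 0).
have e1 : pd1 (p * 'X + c%:P) = pd1 p * 'X + p.
  by rewrite /pd1 derivD derivM derivX derivC addr0 mulr1.
apply: (is_derive_eq D1); rewrite e1 pd2_cons.
rewrite /ev2 !hornerE deriv_comp /a1 /a2 !derivD !derivZ !derivX !derivC !hornerE.
rewrite horner_comp !hornerE /= !(mulr0, add0r, scale0r) /GRing.scale /=; ring.
Qed.

End DirectionalDerivative.

Section OneDimensional.
Context {R : realType}.

Lemma polyint_subst (a b : R) (p u : {poly R}) :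
  polyint a b ((p \Po u) * u^`()) = polyint u.[a] u.[b] p.
Proof.
have -> : (p \Po u) * u^`() = (antideriv p \Po u)^`() by rewrite deriv_comp
  deriv_antideriv.
by rewrite polyint_deriv !horner_comp.
Qed.

Lemma Rintegral_poly (p : {poly R}) :
  \int[lebesgue_measure]_(s in `[0, 1]) p.[s] = polyint 0 1 p.
Proof.
rewrite /Rintegral -{1}(deriv_antideriv p) integral_deriv_poly //.
Qed.

Lemma Rintegral_flip (p : {poly R}) (e : R) : e = 1 \/ e = -1 ->
  \int[lebesgue_measure]_(s in `[0, 1]) p.[e * (1 - 2 * s)] = polyint (-1) 1 p / 2.
Proof.
move=> he; pose u : {poly R} := e%:P * (1 - 2%:P * 'X).
have -> : \int[lebesgue_measure]_(s in `[0, 1]) p.[e * (1 - 2 * s)] = polyint 0 1 (p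
  \Po u).
  by rewrite -Rintegral_poly; apply: eq_Rintegral => s _; rewrite horner_comp /u !hornerE.
have du : u^`() = (- 2 * e)%:P.
  rewrite /u derivM derivB derivM derivX -polyC1 !derivC polyC1.
  by rewrite polyCM polyCN; ring.
have := polyint_subst 0 1 p u; rewrite du mulrC (mul_polyC (- 2 * e)) linearZ /=.
rewrite /u !hornerE.
have t : 1 - 2 = -1 :> R by ring.
have t' : 2 - 1 = 1 :> R by ring.
case: he => ->; rewrite /polyint ?(mulr1, mul1r, mulrN1, subr0, opprB, mulN1r, t,
  opprK) => h.
  by move: h; lra.
by move: h; rewrite t' sub0r; lra.
Qed.

End OneDimensional.

Section Edge.
Context {R : realType}.
Variable (v : 'I_3 -> R * R).
Hypothesis hv : nondegenerate_triangle v.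
Local Notation T := {poly {poly R}}.
Variable l : 'I_3.

Lemma grad_bary : grad (bary v l) 0 = (bary_dx v l, bary_dy v l).
Proof.
have e : bary v l = ev2 (bary_poly v l) by apply/funext => x; rewrite ev2_bary.
rewrite /grad e; congr pair.
  rewrite (@derive_val _ _ _ _ _ _ _ (derive_ev2 _ _ _)) /=.
  rewrite (pd1_bary v l).
  by rewrite /ev2 !hornerE.
rewrite (@derive_val _ _ _ _ _ _ _ (derive_ev2 _ _ _)) /=.
rewrite (pd2_bary v l).
by rewrite /ev2 !hornerE.
Qed.

Lemma edge_vertices : let e := v (l - 1) - v (l + 1) in let w := v l - v (l + 1) in
  [/\ bary_dx v l * orient v = - e.2, bary_dy v l * orient v = e.1 &
      e.1 * w.2 - e.2 * w.1 = orient v].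
Proof.
have := hv; rewrite /nondegenerate_triangle => o0 /=; split.
- by rewrite /bary_dx divfK // opprB.
- by rewrite /bary_dy divfK.
- rewrite /orient /signed_area2; move: l; apply: ord3_cases;
  rewrite !ord3E /=; ring.
Qed.

Lemma enorm_gt0 (x : R * R) : x != 0 -> 0 < enorm x.
Proof.
case: x => a b ab; rewrite /enorm sqrtr_gt0 /dot /= -!expr2 lt_def addr_ge0 ?sqr_ge0 //.
rewrite andbT paddr_eq0 ?sqr_ge0 // !expf_eq0 /=.
by apply: contraNN ab => /andP[/eqP-> /eqP->].
Qed.

Lemma grad_bary_gt0 : 0 < enorm (grad (bary v l) 0).
Proof.
have := hv; rewrite /nondegenerate_triangle => o0; apply: enorm_gt0.
have [h1 h2 h3] := edge_vertices.
rewrite grad_bary; apply: contraNN o0 => /eqP[dx0 dy0].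
by rewrite -h3 -h2 -[X in _ - X * _]opprK -h1 dx0 dy0 !mul0r oppr0 mul0r subrr.
Qed.

Lemma edge_length_gt0 : 0 < edge_length v l.
Proof.
have := hv; rewrite /nondegenerate_triangle => o0; apply: enorm_gt0.
have [_ _ h3] := edge_vertices.
apply: contraNN o0 => /eqP e0; rewrite -h3.
by rewrite e0 /= !mul0r subrr.
Qed.

(** grad lambda_l is orthogonal to e_l, hence parallel to n; its scalar product with
    v l - v (l + 1) is 1, while that of n is negative, hence n = - grad / |grad|. *)
Lemma normal_grad (n : R * R) : outward_unit_normal v l n ->
  n.1 * bary_dx v l + n.2 * bary_dy v l = - enorm (grad (bary v l) 0).
Proof.
have := hv; rewrite /nondegenerate_triangle => o0.
have [h1 h2 h3] := edge_vertices.
have g0 := grad_bary_gt0; move: g0 h1 h2 h3; rewrite grad_bary /enorm.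
rewrite sqrtr_gt0 /dot /=.
move=> g0 h1 h2 h3 [n1 ne nw]; move: h1 h2 h3 n1 ne nw g0.
rewrite /enorm /dot /=.
set e1 := (v (l - 1)).1 - (v (l + 1)).1; set e2 := (v (l - 1)).2 - (v (l + 1)).2.
set w1 := (v l).1 - (v (l + 1)).1; set w2 := (v l).2 - (v (l + 1)).2.
move: (bary_dx v l) (bary_dy v l) => gx gy; move: n => [n1 n2] /=.
clearbody e1 e2 w1 w2; move: o0.
move: (orient v) => o o0 hx hy hw n0 ne nw g0.
have nn : n1 * n1 + n2 * n2 = 1.
  have p0 : 0 <= n1 * n1 + n2 * n2 by rewrite -!expr2 addr_ge0 ?sqr_ge0.
  by rewrite -(sqr_sqrtr p0) n0 expr1n.
have gw : gx * w1 + gy * w2 = 1.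
  apply: (mulIf o0); rewrite mul1r.
  transitivity ((gx * o) * w1 + (gy * o) * w2); first ring.
  by rewrite hx hy -[RHS]hw; ring.
have nperp : - n1 * gy + n2 * gx = 0.
  apply: (mulIf o0); rewrite mul0r -[RHS]oppr0 -ne.
  transitivity (- n1 * (gy * o) + n2 * (gx * o)); first ring.
  by rewrite hx hy; ring.
have sq : (n1 * gx + n2 * gy) ^+ 2 = gx * gx + gy * gy.
  transitivity ((n1 * n1 + n2 * n2) * (gx * gx + gy * gy) - (- n1 * gy + n2 * gx) ^+ 2).
    by ring.
  by rewrite nn nperp; ring.
have neg : n1 * gx + n2 * gy < 0.
  have : (n1 * w1 + n2 * w2) * (gx * gx + gy * gy) = n1 * gx + n2 * gy.
    transitivity ((n1 * gx + n2 * gy) * (gx * w1 + gy * w2) +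
      (- n1 * gy + n2 * gx) * (gx * w2 - gy * w1)); first ring.
    by rewrite gw nperp; ring.
  by move=> <-; rewrite nmulr_rlt0.
by rewrite -sq sqrtr_sqr ltr0_norm // opprK.
Qed.

Definition edge_pt (s : R) := (1 - s) *: v (l + 1) + s *: v (l - 1).

Lemma bary_edge s : [/\ bary v l (edge_pt s) = 0, bary v (l + 1) (edge_pt s) = 1 - s &
  bary v (l - 1) (edge_pt s) = s].
Proof.
pose c (a : 'I_3) := if a == l + 1 then 1 - s else if a == l - 1 then s else 0.
have [e1 e2 e3] : [/\ (l - 1 == l + 1) = false, (l == l + 1) = false & (l == l - 1) =
  false].
  by move: l; apply: ord3_cases; rewrite !ord3E.
have sumE (V : nmodType) (F : 'I_3 -> V) : \sum_a F a = F l + (F (l + 1) + F (l - 1)).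
  rewrite sum_ord3; move: l; apply: ord3_cases; rewrite !ord3E.
  - by rewrite addrA.
  - by rewrite -addrA addrCA [F 0 + _]addrC.
  - by rewrite addrC.
have xE : edge_pt s = \sum_a c a *: v a.
  by rewrite sumE /c !eqxx e1 e2 e3 scale0r add0r.
have c1 : \sum_a c a = 1 by rewrite sumE /c !eqxx e1 e2 e3; ring.
by rewrite xE !bary_barycenter // /c !eqxx e1 e2 e3.
Qed.

(** The edge is parametrized from v (l + 1) to v (l - 1), that is from lambda_l^+ = 1
    to lambda_l^- = 1 for one orientation of the triangle, and backwards for the
    other. *)
Definition orient_sign : R := if 0 < orient v then 1 else -1.

Lemma orient_signP : orient_sign = 1 \/ orient_sign = -1.
Proof. by rewrite /orient_sign; case: ifP; [left | right]. Qed.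

Lemma coord_edge s : sum_coord v l (edge_pt s) = 1 /\ diff_coord v l (edge_pt s) =
  orient_sign * (1 - 2 * s).
Proof.
have [_ h1 h2] := bary_edge s.
by rewrite /sum_coord /diff_coord /nxt /prv /orient_sign; case: ifP => _; rewrite h1
  h2; split; ring.
Qed.

End Edge.

(** * Duality *)
Section ShapeFunctions.
Context {R : realType}.
Variables (v n : 'I_3 -> R * R) (m : nat).
Hypothesis hv : nondegenerate_triangle v.
Hypothesis hn : forall i, outward_unit_normal v i (n i).
Local Notation T := {poly {poly R}}.
Implicit Types (i l : 'I_3) (k d : nat).

Definition shape_fun i k (x : R * R) : R :=
  shape_coef v m.+2 i k * bubble v x * edge_bubble v i x *
  koornwinder 1 2 2 k m (bary v i x) (bary v (nxt v i) x) (bary v (prv v i) x).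

Lemma polyint_jacobi22 k d :
  polyint (-1) 1 (jacobi_weight 2 2 * jacobi 2 2 k * jacobi 2 2 d : {poly R}) =
  if k == d then 32 * ((k + 1) * (k + 2))%:R / ((k + 3) * (k + 4) * (2 * k + 5))%:R
    else 0.
Proof.
case: (ltngtP k d) => [kd|dk|<-]; last exact: jacobi_norm22.
  rewrite mulrAC; apply: (jacobi_orthogonal 2 2).
  by rewrite (leq_trans (size_jacobi _ _ _)).
by apply: (jacobi_orthogonal 2 2); rewrite (leq_trans (size_jacobi _ _ _)).
Qed.

(** Where lambda_l = 0, only the derivative of the factor lambda_l contributes. *)
Lemma derive_edge l (W : T) x : bary v l x = 0 ->
  'D_(n l) (ev2 (bary_poly v l * W)) x = - enorm (grad (bary v l) 0) * ev2 W x.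
Proof.
move=> lx; rewrite (@derive_val _ _ _ _ _ _ _ (derive_ev2 _ _ _)) /=.
rewrite -(normal_grad hv (hn l)).
have -> : pd1 (bary_poly v l * W) = (bary_dx v l)%:P%:P * W + bary_poly v l * pd1 W.
  by rewrite -pd1_bary [LHS]derivM.
rewrite pd2M pd2_bary.
have e1 a (p : T) : ev2 (a%:P%:P * p) x = a * ev2 p x by rewrite /ev2 !hornerE.
have eD (p q : T) : ev2 (p + q) x = ev2 p x + ev2 q x by rewrite /ev2 !hornerE.
rewrite eD !ev2Z !eD !e1 !ev2M !ev2_bary // lx; ring.
Qed.

Definition edge_bubble_poly i : T := bary_poly v (nxt v i) * bary_poly v (prv v i).

Lemma ev2_edge_bubble_poly i x : ev2 (edge_bubble_poly i) x = edge_bubble v i x.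
Proof. by rewrite /edge_bubble_poly ev2M !ev2_bary // edge_bubbleE. Qed.

Lemma edge_bubble_eq0 i l x : i != l -> bary v l x = 0 -> edge_bubble v i x = 0.
Proof. by move=> il lx; rewrite /edge_bubble (bigD1 l) 1?eq_sym //= lx mul0r. Qed.

Lemma sum_pair (F : 'I_3 * 'I_m.+1 -> R) : \sum_ik F ik = \sum_i \sum_k F (i, k).
Proof. by rewrite pair_bigA; apply: eq_bigr => -[]. Qed.

(** The combination is lambda_l W.  In W, every term of an index i <> l still contains
    lambda_l through edge_bubble v i, and vanishes on e_l; the terms of index l
    give (1 - t^2)^2 P_k^(2,2)(t) with t = diff_coord, up to constants. *)
Lemma normal_dof_comb (c : 'I_3 * 'I_m.+1 -> R) l (d : 'I_m.+1) :
  normal_dof v n l d (fun x => \sum_ik c ik * shape_fun ik.1 ik.2 x) = c (l, d).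
Proof.
pose W : T := \sum_(ik : 'I_3 * 'I_m.+1) (c ik * shape_coef v m.+2 ik.1 ik.2)%:P *:
  (edge_bubble_poly l * edge_bubble_poly ik.1 * subst2 (sp v ik.1) (yp v ik.1)
    (koorn_poly m ik.2)).
have eW x : ev2 W x = \sum_(ik : 'I_3 * 'I_m.+1) c ik * shape_coef v m.+2 ik.1 ik.2 *
    (edge_bubble v l x * edge_bubble v ik.1 x *
     ev2 (koorn_poly m ik.2) (sum_coord v ik.1 x, diff_coord v ik.1 x)).
  rewrite /W /ev2 !horner_sum; apply: eq_bigr => ik _.
  by rewrite -/(ev2 _ x) ev2Z (ev2M (edge_bubble_poly l * edge_bubble_poly ik.1)) (ev2M
    (edge_bubble_poly l)) !ev2_edge_bubble_poly ev2_coord.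
have fW : (fun x => \sum_ik c ik * shape_fun ik.1 ik.2 x) = ev2 (bary_poly v l * W).
  apply/funext => x; rewrite ev2M ev2_bary // eW mulr_sumr; apply: eq_bigr => ik _.
  by rewrite /shape_fun koornwinder_koorn_poly // (bubbleE v l); ring.
(* The constant that remains of shape_coef once |grad lambda_l| and the value of the
   radial factor at s = 1 have cancelled; 16 comes from ((1 - t^2) / 4)^2. *)
pose kap k : R := ((k + 3) * (k + 4) * (2 * k + 5))%:R / (16 * ((k + 1) * (k + 2))%:R).
pose g : {poly R} := \sum_(k < m.+1) (c (l, k) * kap k) *: (jacobi_weight 2 2 * jacobi
  2 2 k * jacobi 2 2 d).
have G0 := grad_bary_gt0 hv l.
have onedge s : 'D_(n l) (ev2 (bary_poly v l * W)) (edge_pt v l s) *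
    (jacobi 2 2 d).[bary v (nxt v l) (edge_pt v l s) - bary v (prv v l) (edge_pt v l s)] =
    g.[orient_sign v * (1 - 2 * s)].
  have [lx _ _] := bary_edge hv l s.
  have [sx dx] := coord_edge hv l s.
  rewrite derive_edge // -/(diff_coord v l _) dx; set t := orient_sign v * _ in dx *.
  rewrite eW sum_pair.
  rewrite (bigD1 l) //= [X in _ + X]big1 ?addr0; last first.
    move=> i il; rewrite big1 // => k _.
    by rewrite (edge_bubble_eq0 il lx) !(mulr0, mul0r).
  rewrite sx dx mulr_sumr mulr_suml /g horner_sum; apply: eq_bigr => k _.
  have -> : edge_bubble v l (edge_pt v l s) = (1 - t ^+ 2) / 4.
    by rewrite edge_bubbleE bary_nxt_coord bary_prv_coord sx dx; field.
  rewrite ev2_koorn_poly ev2_homogE ?size_jacobi ?oner_eq0 // expr1n mul1r divr1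
    horner_radial1.
  rewrite hornerZ -[jacobi_weight 2 2 * _ * _]mulrA (hornerM (jacobi_weight 2 2))
    jacobi_weightE hornerM /kap /shape_coef.
  have -> : (m.+2 - k - 1 = (m - k).+1)%N by have := ltn_ord k; lia.
  set N := enorm _ in G0 *; have N0 : N != 0 by rewrite gt_eqF.
  have sgn : (-1) ^+ (m - k) * (-1) ^+ (m - k) = 1 :> R.
    by rewrite -exprMn mulrNN mulr1 expr1n.
  rewrite exprS; move: sgn; set e := (-1) ^+ (m - k) => sgn.
  rewrite !natrM.
  have a0 : (m - k).+1%:R != 0 :> R by rewrite pnatr_eq0.
  have b0 : (k + 1)%:R != 0 :> R by rewrite pnatr_eq0 addn1.
  have c0 : (k + 2)%:R != 0 :> R by rewrite pnatr_eq0 addn2.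
  move: a0 b0 c0; move: ((m - k).+1%:R : R) ((k + 1)%:R : R) ((k + 2)%:R : R).
  move=> A B C a0 b0 c0.
  transitivity (e * e * ((c (l, k) * ((k + 3)%:R * (k + 4)%:R * (2%:R * k%:R + 5) / (16
    * (B * C)))) *
    ((1 - t) ^+ 2 * (1 + t) ^+ 2 * (jacobi 2 2 k).[t] * (jacobi 2 2 d).[t]))); last first.
    by rewrite sgn mul1r (natrD _ (2 * k) 5) natrM; ring.
  by rewrite (natrD _ (2 * k) 5) natrM; field; rewrite N0 a0 b0 c0.
rewrite /normal_dof /edge_integral fW.
rewrite mulKf; last by rewrite gt_eqF // edge_length_gt0.
rewrite -/(edge_pt v l _).
transitivity (\int[lebesgue_measure]_(s in `[0, 1]) g.[orient_sign v * (1 - 2 * s)]).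
  by apply: eq_Rintegral => s _; exact: onedge.
rewrite (Rintegral_flip _ (orient_signP v)) /g linear_sum /= (bigD1 d) //= big1 ?addr0;
  last first.
  move=> k kd; rewrite linearZ /= polyint_jacobi22 (_ : ((k : nat) == d) = false)
    ?mulr0 //.
  exact: negbTE kd.
rewrite linearZ /= polyint_jacobi22 eqxx /kap !natrM.
have b0 : (d + 1)%:R != 0 :> R by rewrite pnatr_eq0 addn1.
have c0 : (d + 2)%:R != 0 :> R by rewrite pnatr_eq0 addn2.
have d0 : (d + 3)%:R != 0 :> R by rewrite pnatr_eq0 addn3.
have e0 : (d + 4)%:R != 0 :> R by rewrite pnatr_eq0 addn4.
have f0 : (2 * d + 5)%:R != 0 :> R by rewrite pnatr_eq0 addnC.
move: b0 c0 d0 e0 f0.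
move: ((d + 1)%:R : R) ((d + 2)%:R : R) ((d + 3)%:R : R) ((d + 4)%:R : R) ((2 * d +
  5)%:R : R).
by move=> B C D E F *; field; do ?[apply/andP; split].
Qed.

Lemma shape_coef_neq0 i k : (k <= m)%N -> shape_coef v m.+2 i k != 0.
Proof.
move=> km; have G0 := grad_bary_gt0 hv i.
have -> : shape_coef v m.+2 i k = (-1) ^+ (m.+2 - k - 1) / enorm (grad (bary v i) 0) *
  (((k + 3) * (k + 4) * (2 * k + 5))%:R / ((m.+2 - k - 1) * (k + 1) * (k + 2))%:R) by [].
rewrite !mulf_neq0 ?invr_eq0 ?expf_neq0 ?oppr_eq0 ?oner_eq0 ?(gt_eqF G0) //
  pnatr_eq0 -lt0n !muln_gt0; apply/andP; split; lia.
Qed.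

Lemma bubble_space_shape_fun i k : (k <= m)%N -> bubble_space v m%:Z (shape_fun i k).
Proof.
move=> km.
exists (fun l x => (if l == i then shape_coef v m.+2 i k else 0) *
  koornwinder 1 2 2 k m (bary v l x) (bary v (nxt v l) x) (bary v (prv v l) x)); split.
  by move=> l; exact: koornwinder_Qspace.
move=> x; rewrite (bigD1 i) //= eqxx big1 ?addr0; last first.
  by move=> l /negPf->; rewrite mul0r mulr0.
by rewrite /shape_fun; ring.
Qed.

Lemma bubble_space_span (f : R * R -> R) : bubble_space v m%:Z f ->
  exists c : {ffun 'I_3 * 'I_m.+1 -> R}, forall x, f x = \sum_ik c ik * shape_fun ik.1
    ik.2 x.
Proof.
move=> [q [hq fq]].
have [c hc] := choice (fun i => Qspace_span hv (hq i)).
exists [ffun ik : 'I_3 * 'I_m.+1 => c ik.1 ik.2 / shape_coef v m.+2 ik.1 ik.2] => x.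
rewrite fq mulr_sumr.
rewrite sum_pair.
apply: eq_bigr => i _; rewrite hc !mulr_sumr; apply: eq_bigr => k _.
rewrite ffunE /= /shape_fun.
have : shape_coef v m.+2 i k != 0 by apply: shape_coef_neq0; rewrite -ltnS.
by move: (shape_coef v m.+2 i k) => s s0; field.
Qed.

Lemma shape_functions_shape_fun :
  shape_functions (bubble_space v m%:Z)
    (fun (ik : 'I_3 * 'I_m.+1) f => normal_dof v n ik.1 ik.2 f)
    (fun (ik : 'I_3 * 'I_m.+1) => shape_fun ik.1 ik.2).
Proof.
split=> [[i k]|f /bubble_space_span[c hc]|[i k] [i' k']] /=.
- by apply: bubble_space_shape_fun; rewrite -ltnS.
- exists c; split=> // c' hc'; apply/ffunP => -[i k].
  rewrite -(normal_dof_comb c) -(normal_dof_comb c'); congr normal_dof.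
  by apply/funext => x; rewrite -hc -hc'.
- rewrite -(normal_dof_comb (fun ik => (ik == (i', k'))%:R)); congr normal_dof.
  apply/funext => x; rewrite (bigD1 (i', k')) //= eqxx mul1r big1 ?addr0 //.
  by move=> ik /negPf->; rewrite mul0r.
Qed.

End ShapeFunctions.

Theorem lemma3p5 (R : realType) (r : nat) (v n : 'I_3 -> R * R)
    (hr : (2 <= r)%N) (hv : nondegenerate_triangle v)
    (hn : forall i, outward_unit_normal v i (n i)) :
  shape_functions
    (bubble_space v (r%:Z - 2))
    (fun (ik : 'I_3 * 'I_(r - 1)) f => normal_dof v n ik.1 ik.2 f)
    (fun (ik : 'I_3 * 'I_(r - 1)) x =>
      shape_coef v r ik.1 ik.2 * bubble v x * edge_bubble v ik.1 x *
      koornwinder 1 2 2 ik.2 (r - 2)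
        (bary v ik.1 x) (bary v (nxt v ik.1) x) (bary v (prv v ik.1) x)).
Proof.
case: r hr => [|[|m]] // _.
have -> : m.+2%:Z - 2 = m%:Z by rewrite -addn2 PoszD addrK.
have -> : (m.+2 - 2 = m)%N by rewrite subn2.
exact: shape_functions_shape_fun.
Qed.
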